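(* Fix $s\in\mathbb{C}$ and $0\le x<1$, and let $z_0\in\mathbb{C}$ be a pole of the (meromorphically continued) function $z\mapsto\varphi(z,s,x)$. The residue of $\varphi(z,s,x)$ at $z=z_0$ is a polynomial in $x$. More precisely, there is some $j_0\in\mathbb{N}$ such that $$\operatorname{res}_{z=z_0}\varphi(z,s,x)=\sum_{j=0}^{j_0}\binom{-s}{j}\left(\operatorname{res}_{z=z_0}\varphi(z,s+j,0)\right)x^j .$$ Furthermore, for the case $x=0$ (so $z_0$ is a pole of $z\mapsto\varphi(z,s,0)$), if $\boldsymbol{\tau}(z_0)$ is the set of $(r-1)$-tuples $(k_1,\dots,k_{r-1})$ of integers with $k_1\ge\dots\ge k_{r-1}\ge0$ such that $$z_0=\alpha_1^{s+k_1}\alpha_2^{-k_1+k_2}\cdots\alpha_{r-1}^{-k_{r-2}+k_{r-1}}\alpha_r^{-k_{r-1}}$$ (which is a finite set), then $$\operatorname{res}_{z=z_0}\varphi(z,s,0)=-z_0\sum_{(k_1,\dots,k_{r-1})\in\boldsymbol{\tau}(z_0)}\Lambda_{k_1,\dots,k_{r-1}}(s).$$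
   Context: Setting: $\{a_n\}_{n\ge 1}$ is a linear recurrence sequence over $\mathbb{Z}$, i.e. a sequence of integers for which there is a monic $Q\in\mathbb{Z}[X]$ with $Q(\nabla)a_n=0$ for all $n$, where $\nabla a_n=a_{n+1}$. Its minimal polynomial $P\in\mathbb{Z}[X]$ (the monic polynomial of least degree with $P(\nabla)$ annihilating $\{a_n\}$) is assumed irreducible over $\mathbb{Q}$, of degree $r$, with (simple) roots $\alpha_1,\dots,\alpha_r\in\mathbb{C}$, and $\alpha_1$ is a dominant root: $\alpha_1$ is real, $\alpha_1>1$ and $\alpha_1>|\alpha_i|$ for $i=2,\dots,r$. There are constants $\lambda_i\in\mathbb{Q}(\alpha_i)$ with $a_n=\lambda_1\alpha_1^n+\dots+\lambda_r\alpha_r^n$ for all $n$ (generalized Binet formula). The sequence $\{a_n\}$ is assumed to be a strictly increasing sequence of positive integers (so $\lambda_1>0$). For $0\le x<1$ and fixed $s\in\mathbb{C}$, $\varphi(z,s,x)$ denotes the meromorphic continuation to the whole $z$-plane of the power series $\sum_{n=1}^{\infty}z^n(a_n+x)^{-s}$, which converges for $|z|<\alpha_1^{\Re(s)}$. Complex powers of positive reals are defined through the real logarithm. For integers $k_1\ge\dots\ge k_{r-1}\ge0$, $$\Lambda_{k_1,\dots,k_{r-1}}(s)=\binom{-s}{k_1}\binom{k_1}{k_2}\cdots\binom{k_{r-2}}{k_{r-1}}\;\lambda_1^{-s-k_1}\lambda_2^{k_1-k_2}\cdots\lambda_{r-1}^{k_{r-2}-k_{r-1}}\lambda_r^{k_{r-1}},$$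 where $\binom{-s}{j}=\frac{(-s)(-s-1)\cdots(-s-j+1)}{j!}$. With the convention $k_r=0$, the products of powers are $\lambda_1^{-s-k_1}\prod_{i=2}^r\lambda_i^{k_{i-1}-k_i}$ and $\alpha_1^{s+k_1}\prod_{i=2}^r\alpha_i^{k_i-k_{i-1}}$. Also $x^0=1$, and a residue at a point of holomorphy is $0$. *)

(* Defs.v *)
From HB Require Import structures.
From mathcomp Require Import all_boot all_order all_algebra.
From mathcomp Require Import all_classical all_reals all_analysis.
From mathcomp Require Import complex.

Set Implicit Arguments.
Unset Strict Implicit.
Unset Printing Implicit Defensive.

Import Order.TTheory GRing.Theory Num.Theory.
Import numFieldNormedType.Exports.

Local Open Scope classical_set_scope.
Local Open Scope ring_scope.
Local Open Scope complex_scope.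

Section LinearRecurrence.

(* Sequences are indexed by n >= 1; the value a 0 is never used. *)
Definition annihilates (Q : {poly int}) (a : nat -> int) : Prop :=
  forall n, (1 <= n)%N -> \sum_(i < size Q) Q`_i * a (n + i)%N = 0.

Definition is_minimal_polynomial (P : {poly int}) (a : nat -> int) : Prop :=
  [/\ P \is monic, annihilates P a &
      forall Q : {poly int}, Q \is monic -> annihilates Q a ->
        (size P <= size Q)%N].

Definition in_Q_adjoin (F : fieldType) (y x : F) : Prop :=
  exists p q : {poly rat},
    (map_poly ratr q).[y] != 0 /\
    x = (map_poly ratr p).[y] / (map_poly ratr q).[y].

End LinearRecurrence.

Section Meromorphic.
Variable K : numFieldType.
Implicit Types (f : K -> K) (z : K).

(* f z = \sum_(n >= 0) c_n (z - z0)^(n - N) on a punctured disk around z0: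
   a Laurent expansion with finite principal part. *)
Definition laurent_expansion f (z0 : K) (N : nat) (c : nat -> K) : Prop :=
  \forall z \near z0^',
    (\sum_(0 <= n < m) c n * (z - z0) ^ (n%:Z - N%:Z)) @[m --> \oo] --> f z.

(* The value of f at the expansion point is not constrained, since a function
   into K has no proper value to take at a pole. *)
Definition meromorphic f : Prop :=
  forall z0, exists N c, laurent_expansion f z0 N c.

Definition pole f z0 : Prop :=
  exists N c, [/\ (0 < N)%N, laurent_expansion f z0 N c & c 0%N != 0].

(* In an expansion starting at exponent -(N+1), the coefficient of
   (z - z0)^(-1) is c N. *)
Definition is_residue f z0 (rho : K) : Prop :=
  exists N c, laurent_expansion f z0 N.+1 c /\ rho = c N.

Definition residue f z0 : K := xget 0 [set rho | is_residue f z0 rho].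

(* g is a meromorphic continuation of \sum_(n >= 1) u_n z^n, |z| < rho. *)
Definition continues_series (u : nat -> K) (rho : K) (g : K -> K) : Prop :=
  meromorphic g /\
  forall z, `|z| < rho ->
    (\sum_(1 <= n < m) u n * z ^+ n) @[m --> \oo] --> g z.

Definition meromorphic_continuation (u : nat -> K) (rho : K) : K -> K :=
  xget (fun=> 0) [set g | continues_series u rho g].

End Meromorphic.

Section LerchZeta.
Variable R : realType.
Implicit Types (s : R[i]) (alpha lam : nat -> R[i]).

(* t^s = exp (s ln t), for t > 0 real and s complex *)
Definition cpow (t : R) s : R[i] :=
  (t `^ complex.Re s)%:C *
  (cos (complex.Im s * ln t) +i* sin (complex.Im s * ln t)).

Definition cbinom (y : R[i]) (j : nat) : R[i] :=
  (\prod_(i < j) (y - i%:R)) / j`!%:R.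

(* alpha1 is only used when it is real: it is the dominant root. *)
Definition phi (a : nat -> int) (alpha1 : R[i]) s (x : R) : R[i] -> R[i] :=
  meromorphic_continuation (fun n => cpow ((a n)%:~R + x) (- s))
    (complex.Re alpha1 `^ complex.Re s)%:C.

(* For k = (k_1, ..., k_(r-1)), kth k i is k_i for 1 <= i < r, and the default
   value of nth gives kth k r = 0. The case r = 1 is covered: then k = [::],
   and k_1 = k_r = 0. *)
Definition kth (k : seq nat) (i : nat) : nat := nth 0%N k i.-1.

Definition tau (r : nat) alpha s (z0 : R[i]) : set (r.-1.-tuple nat) :=
  [set k | sorted geq k /\
     z0 = cpow (complex.Re (alpha 1%N)) (s + (kth k 1)%:R) *
          \prod_(2 <= i < r.+1) alpha i ^ ((kth k i)%:Z - (kth k i.-1)%:Z)].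

(* lambda_1 lies in Q(alpha_1), hence is real, and it is positive because
   (a_n) is; so the power of lambda_1 is taken through its real part. The
   differences k_(i-1) - k_i are nonnegative for k in tau. *)
Definition Lambda (r : nat) lam s (k : r.-1.-tuple nat) : R[i] :=
  cbinom (- s) (kth k 1) *
  \prod_(1 <= i < r.-1) 'C(kth k i, kth k i.+1)%:R *
  cpow (complex.Re (lam 1%N)) (- s - (kth k 1)%:R) *
  \prod_(2 <= i < r.+1) lam i ^+ (kth k i.-1 - kth k i).

End LerchZeta.

Arguments tau {R} r alpha s z0.

(* Main.v *)
Require Import Defs.
From mathcomp Require Import all_boot all_order all_algebra.
From mathcomp Require Import all_classical all_reals all_analysis.
From mathcomp Require Import complex ring lra zify.

Set Implicit Arguments.
Unset Strict Implicit.
Unset Printing Implicit Defensive.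

Import Order.TTheory GRing.Theory Num.Theory.
Import numFieldNormedType.Exports.

Local Open Scope classical_set_scope.
Local Open Scope ring_scope.
Local Open Scope complex_scope.

Import Normc.

(** The proof reads off poles and residues from exponential expansions of the
coefficients. If [u n] is a finite sum of terms [c b^n] up to [O(q^n)], then
[\sum_n u_n z^n] is the sum of the rational functions [c b z / (1 - b z)] and of
a power series that converges for [|z| < 1/q]. So it continues meromorphically to
that disc, where [c b z / (1 - b z)] has a simple pole at [1/b], of residue
[- c/b]. When such expansions exist for all [q > 0], the continuations to the
various discs agree by the identity theorem ([identity_segment]) and glue
([continuation_exists]); the residue at [z0] is then [- z0] times the sum of the
[c] with [b z0 = 1], whatever expansion on a disc around [z0] is used
([continuation_residue]).

It remains to expand [(a_n + x)^(-s)]. Its dominant term is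
[lam_1 alpha_1^n], where [lam_1 > 0]: the ratios [a_n / alpha_1^n] are positive
and tend to [lam_1], which is nonzero because otherwise the integers [a_n] would
satisfy a linear recurrence of order less than [r] over the complex numbers,
hence over the rationals (a Hankel determinant vanishes), against the
irreducibility of [P] ([dominant_coef_neq0]). With
[a_n = lam_1 alpha_1^n (1 + t_n)], where [t_n] is real and decays geometrically,
the binomial series of [(1 + t_n)^(-s)], truncated with an error [O(t_n^M)]
([taylor_error_bound]), and the multinomial expansion of the powers of
[\sum_(i >= 2) lam_i alpha_i^n] ([nested_multinomial]) give the terms
[Lambda_k(s) b_k^n], where [1/b_k] is the candidate pole that defines [tau]
([expansion_at_0]). This is the formula for [x = 0], and [tau] is finite because
[|b_k|] decays geometrically in [k_1].

For general [x] the binomial series of [(1 + x/a_n)^(-s)] writes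
[(a_n + x)^(-s)] as the sum of the [binom(-s, j) x^j a_n^(-s-j)], up to an error
of the order of [a_n^(-s-J)] after [J] terms ([expansion_at_x]). Residues are
linear in expansions, which gives the polynomial in [x]; the number [J] of terms
depends only on [s] and [|z0|]. *)

(** * Limits of complex sequences *)

Section Limits.
Variable R : realType.
Local Notation C := R[i].
Implicit Types (z w l : C) (u v c : nat -> C).

Lemma norm_normc z : `|z| = (normc z)%:C.
Proof. by []. Qed.

Lemma ReB z w : complex.Re (z - w) = complex.Re z - complex.Re w.
Proof. by case: z w => [? ?] [? ?]. Qed.

Lemma ImB z w : complex.Im (z - w) = complex.Im z - complex.Im w.
Proof. by case: z w => [? ?] [? ?]. Qed.

Lemma Re_sum (I : Type) (s : seq I) (Q : pred I) (F : I -> C) :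
  complex.Re (\sum_(i <- s | Q i) F i) = \sum_(i <- s | Q i) complex.Re (F i).
Proof. by apply: (big_morph (@complex.Re R)) => // -[? ?] [? ?]. Qed.

Lemma Im_sum (I : Type) (s : seq I) (Q : pred I) (F : I -> C) :
  complex.Im (\sum_(i <- s | Q i) F i) = \sum_(i <- s | Q i) complex.Im (F i).
Proof. by apply: (big_morph (@complex.Im R)) => // -[? ?] [? ?]. Qed.

Lemma normc_ge0 z : 0 <= normc z.
Proof. by case: z => x y; apply: sqrtr_ge0. Qed.

Lemma normc_eq0 z : (normc z == 0) = (z == 0).
Proof. by apply/eqP/eqP => [/eq0_normc//|->]; exact: normc0. Qed.

Lemma normc_gt0 z : (0 < normc z) = (z != 0).
Proof. by rewrite lt_def normc_eq0 normc_ge0 andbT. Qed.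

Lemma normcX z n : normc (z ^+ n) = normc z ^+ n.
Proof.
elim: n => [|n IH]; first by rewrite !expr0 normc1.
by rewrite !exprS normcM IH.
Qed.

Lemma normc_real (x : R) : normc x%:C = `|x|.
Proof. by rewrite /normc /= expr0n addr0 sqrtr_sqr. Qed.

Lemma normc_sum (I : Type) (s : seq I) (Q : pred I) (F : I -> C) :
  normc (\sum_(i <- s | Q i) F i) <= \sum_(i <- s | Q i) normc (F i).
Proof.
elim/big_ind2 : _ => [|x a y b xa yb|//]; first by rewrite normc0.
by rewrite (le_trans (le_normcD _ _))// lerD.
Qed.

Lemma normcB z w : normc (z - w) = normc (w - z).
Proof. by rewrite -normcN opprB. Qed.

Lemma Re_le_normc z : `|complex.Re z| <= normc z.
Proof. by have := normc_ge_Re z; rewrite norm_normc lecR. Qed.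

Lemma Im_le_normc z : `|complex.Im z| <= normc z.
Proof.
case: z => x y /=; rewrite -sqrtr_sqr ler_wsqrtr// lerDr.
exact: sqr_ge0.
Qed.

Lemma normc_le_ReIm z : normc z <= `|complex.Re z| + `|complex.Im z|.
Proof.
rewrite [z in normc z]complexE (le_trans (le_normcD _ _))//.
by rewrite normcM !normc_real /= expr0n expr1n add0r sqrtr1 mul1r.
Qed.

(** Convergence with real tolerances: the order of [R[i]] is only partial, which
makes estimates with complex tolerances awkward. *)
Definition climit u l : Prop :=
  forall e : R, 0 < e -> exists N, forall n, (N <= n)%N -> normc (l - u n) < e.

(** The topology of [R[i]] is the one of its structure of [numFieldType]. *)
Lemma climitP (u : nat -> (C : numFieldType)) (l : (C : numFieldType)) :
  u @ \oo --> l <-> climit u l.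
Proof.
split=> [/cvgrPdist_lt ul e e0|h].
  have /ul[N _ hN] : 0 < e%:C by rewrite ltcR.
  by exists N => n Nn; have := hN n Nn; rewrite norm_normc ltcR.
apply/cvgrPdist_lt => e; rewrite ltcE => /andP[/eqP e0 /h[N hN]].
exists N => // n /= Nn; rewrite norm_normc ltcE /= e0 eqxx /=.
exact: hN.
Qed.

Lemma dnbhscP (z0 : (C : numFieldType)) (Q : C -> Prop) : (\forall z \near z0^', Q z) <->
  exists2 e : R, 0 < e & forall z, z != z0 -> normc (z - z0) < e -> Q z.
Proof.
split=> [[e /= e0 he]|[e e0 he]].
  move: e0; rewrite ltcE => /andP[/eqP /= eI e0].
  exists (complex.Re e) => // z zz0 ze; apply: he => //=.
  by rewrite distrC norm_normc ltcE /= eI eqxx.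
exists e%:C => /=; first by rewrite ltcR.
by move=> z; rewrite /= distrC norm_normc ltcR => zz0 zn; apply: he.
Qed.

Lemma climit_cst z : climit (fun=> z) z.
Proof. by move=> e e0; exists 0%N => n _; rewrite subrr normc0. Qed.

Lemma climitD u v l k : climit u l -> climit v k ->
  climit (fun n => u n + v n) (l + k).
Proof.
move=> ul vk; move=> e e0.
have e20 : 0 < e / 2 by rewrite divr_gt0.
have [N1 h1] := ul _ e20; have [N2 h2] := vk _ e20.
exists (maxn N1 N2) => n; rewrite geq_max => /andP[/h1 {}h1 /h2 {}h2].
rewrite opprD addrACA (le_lt_trans (le_normcD _ _))// [e]splitr; exact: ltrD.
Qed.

Lemma climitZ z u l : climit u l -> climit (fun n => z * u n) (z * l).
Proof.
have [->|z0] := eqVneq z 0.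
  by move=> _; under eq_fun do rewrite mul0r; rewrite mul0r; exact: climit_cst.
have nz0 : 0 < normc z by rewrite normc_gt0.
move=> ul; move=> e e0.
have [N hN] := ul (e / normc z) (divr_gt0 e0 nz0).
by exists N => n /hN; rewrite -mulrBr normcM ltr_pdivlMr// mulrC.
Qed.

Lemma climitB u v l k : climit u l -> climit v k ->
  climit (fun n => u n - v n) (l - k).
Proof.
move=> ul /(climitZ (-1)); rewrite mulN1r => /(climitD ul).
by under eq_fun do rewrite mulN1r.
Qed.

Lemma climit_le u l (b : R) m :
  climit u l -> (forall n, (m <= n)%N -> normc (u n) <= b) -> normc l <= b.
Proof.
move=> ul ub; rewrite leNgt; apply/negP => bl.
have /ul[N /(_ (maxn N m))] : 0 < normc l - b by rewrite subr_gt0.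
rewrite leq_maxl => /(_ isT).
have := ub (maxn N m); rewrite leq_maxr => /(_ isT).
have := le_normcD (l - u (maxn N m)) (u (maxn N m)); rewrite subrK.
by move=> ? ? ?; lra.
Qed.

Lemma climit_unique u l k : climit u l -> climit u k -> l = k.
Proof.
move=> ul uk; apply/eqP; rewrite -subr_eq0 -normc_eq0 eq_le normc_ge0 andbT.
apply: (climit_le (m := 0) (climitB ul uk)) => n _.
by rewrite subrr normc0.
Qed.

Lemma climit_ext u v l : (exists m, forall n, (m <= n)%N -> u n = v n) ->
  climit u l -> climit v l.
Proof.
move=> [m uv] ul; move=> e /ul[N hN]; exists (maxn m N) => n.
by rewrite geq_max => /andP[/uv <- /hN].
Qed.

Lemma climit_dominated u l (d : nat -> R) :
  (forall n, normc (l - u n) <= d n) -> (d @ \oo --> (0 : R)) -> climit u l.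
Proof.
move=> ud /cvgrPdist_lt d0; move=> e /d0[N _ hN]; exists N => n Nn.
rewrite (le_lt_trans (ud n))// (le_lt_trans _ (hN n Nn))//.
by rewrite sub0r normrN ler_norm.
Qed.

Lemma sum_geometric_le (q : R) m n : 0 <= q -> q < 1 ->
  \sum_(m <= i < n) q ^+ i <= q ^+ m / (1 - q).
Proof.
move=> q0 q1; have q1' : 0 < 1 - q by rewrite subr_gt0.
have [mn|nm] := leqP m n; last first.
  by rewrite big_geq ?(ltnW nm)// divr_ge0 ?exprn_ge0// ltW.
rewrite ler_pdivlMr//; suff -> : (\sum_(m <= i < n) q ^+ i) * (1 - q) = q ^+ m - q ^+ n.
  by rewrite lerBlDr lerDl exprn_ge0.
elim: n mn => [|n IH]; first by rewrite leqn0 => /eqP ->; rewrite big_geq// mul0r subrr.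
rewrite leq_eqVlt => /orP[/eqP <-|]; first by rewrite big_geq// mul0r subrr.
rewrite ltnS => mn; rewrite big_nat_recr//= mulrDl IH// exprS; ring.
Qed.

(** The real and imaginary parts are dominated by the same geometric series, so
that the completeness of [R] suffices. *)
Lemma cvg_geometric_dominated v (A q : R) : 0 <= q -> q < 1 ->
    (forall n, normc (v n) <= A * q ^+ n) ->
  exists l : C, climit (fun m => \sum_(0 <= n < m) v n) l.
Proof.
move=> q0 q1 vb.
have geo : cvgn (series (fun n => A * q ^+ n)).
  by apply: is_cvg_geometric_series; rewrite ger0_norm.
have real_part (f : C -> R) : (forall z, `|f z| <= normc z) ->
    cvgn (series (fun n => f (v n))).
  move=> fle; apply: normed_cvg.
  apply: (series_le_cvg _ _ _ geo) => n //=; rewrite (le_trans _ (vb n))//.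
  exact: normc_ge0.
have /cvg_ex[x cx] := real_part _ Re_le_normc.
have /cvg_ex[y cy] := real_part _ Im_le_normc.
exists (x +i* y).
move=> e e0; have e20 : 0 < e / 2 by rewrite divr_gt0.
move/cvgrPdist_lt : cx => /(_ _ e20)[N1 _ h1].
move/cvgrPdist_lt : cy => /(_ _ e20)[N2 _ h2].
exists (maxn N1 N2) => n; rewrite geq_max => /andP[/h1 {}h1 /h2 {}h2].
rewrite (le_lt_trans (normc_le_ReIm _))// [e]splitr ltrD//.
  by move: h1; rewrite ReB Re_sum.
by move: h2; rewrite ImB Im_sum.
Qed.
End Limits.

(** * Laurent expansions and the identity theorem *)

Section PowerSeries.
Variable R : realType.
Local Notation C := R[i].
Implicit Types (z w l : C) (c d : nat -> C) (f g : C -> C).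

(** If [c n] were the first nonzero coefficient, then [c n * w ^+ n] would be
cancelled, at the zeros [w] of [f], by a tail of order [w ^+ n.+1]; this fails
for [w] small. *)
Lemma power_series_zero c f (e : R) : 0 < e ->
    (forall w, w != 0 -> normc w < e ->
       climit (fun m => \sum_(0 <= n < m) c n * w ^+ n) (f w)) ->
    (forall r : R, 0 < r -> exists w, [/\ w != 0, normc w < r & f w = 0]) ->
  forall n, c n = 0.
Proof.
move=> e0 cf zf.
pose s : R := e / 2; have s0 : 0 < s by rewrite divr_gt0.
have nsC : normc s%:C = s by rewrite normc_real gtr0_norm.
(* the terms of a convergent series are bounded *)
have [B [B0 cB]] : exists B : R, 0 <= B /\ forall n, normc (c n) * s ^+ n <= B.
  have /cf : s%:C != 0 by rewrite -normc_gt0 nsC.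
  rewrite nsC => /(_ _); rewrite ltr_pdivrMr// => /(_ _ 1 ltr01).
  rewrite ltr_pMr// ltr1n => /(_ isT)[N hN].
  (* past [N], each term is a difference of two partial sums close to the limit *)
  exists (2 + \sum_(0 <= n < N) normc (c n) * s ^+ n).
  have pos m : 0 <= \sum_(0 <= n < m) normc (c n) * s ^+ n.
    by apply: sumr_ge0 => i _; rewrite mulr_ge0 ?normc_ge0 ?exprn_ge0// ltW.
  split=> [|n]; first by rewrite addr_ge0.
  have [nN|Nn] := ltnP n N.
    rewrite (big_cat_nat (leq0n n.+1))//= big_nat_recr//=.
    have := pos n.
    have : 0 <= \sum_(n.+1 <= i < N) normc (c i) * s ^+ i.
      by apply: sumr_ge0 => i _; rewrite mulr_ge0 ?normc_ge0 ?exprn_ge0// ltW.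
    by move=> ? ?; lra.
  have h1 := hN _ Nn; have h2 := hN _ (leqW Nn).
  move: h2; rewrite big_nat_recr//=; set S := \sum_(_ <= _ < _) _ in h1 *.
  move=> h2; have := le_normcD (f s%:C - S) (- (f s%:C - (S + c n * s%:C ^+ n))).
  rewrite normcN [X in normc X](_ : _ = c n * s%:C ^+ n); last by ring.
  rewrite normcM normcX nsC => h3; rewrite (le_trans h3)//.
  have pN := pos N. lra.
move=> n; elim/ltn_ind: n => n IH; apply/eqP; rewrite -normc_eq0; apply/eqP.
apply/le_anti; rewrite normc_ge0 andbT leNgt; apply/negP => cn0.
pose D := 2 * B / s ^+ n.+1.
have D0 : 0 <= D by rewrite !mulr_ge0// invr_ge0 exprn_ge0// ltW.
pose r : R := Num.min (s / 2) (normc (c n) / (D + 1)).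
have r0 : 0 < r by rewrite lt_min !divr_gt0// ltr_wpDl.
have [w [w0 wr fw]] := zf r r0; move: wr; rewrite lt_min => /andP[ws wD].
have nw0 : 0 < normc w by rewrite normc_gt0.
have we : normc w < e by move: ws; rewrite /s; lra.
have {}cfw := cf w w0 we; rewrite fw in cfw.
have q0 : 0 <= normc w / s by rewrite divr_ge0 // ltW.
have q1 : normc w / s <= 1 / 2 by rewrite ler_pdivrMr//; lra.
have tail m : (n < m)%N ->
    normc (c n * w ^+ n - \sum_(0 <= i < m) c i * w ^+ i) <= D * normc w ^+ n.+1.
  move=> nm; rewrite (big_cat_nat (leq0n n.+1))//= big_nat_recr//=.
  rewrite big_nat big1 ?add0r; last by move=> i /andP[_ /IH ->]; rewrite mul0r.
  rewrite opprD addrA subrr add0r normcN (le_trans (normc_sum _ _ _))//.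
  apply: (@le_trans _ _ (\sum_(n.+1 <= i < m) B * (normc w / s) ^+ i)).
    apply: ler_sum => i _; rewrite normcM normcX expr_div_n mulrA mulrAC.
    by rewrite ler_wpM2r ?exprn_ge0 ?normc_ge0// ler_pdivlMr ?exprn_gt0.
  rewrite -mulr_sumr (le_trans (ler_wpM2l B0 (sum_geometric_le _ _ q0 _)))//.
    by rewrite (le_lt_trans q1)//; lra.
  rewrite /D expr_div_n.
  have h1 : (1 - normc w / s)^-1 <= 2 by rewrite -[leRHS]invrK lef_pV2 ?posrE//; lra.
  have -> : B * (normc w ^+ n.+1 / s ^+ n.+1 / (1 - normc w / s)) =
     (B * normc w ^+ n.+1 / s ^+ n.+1) * (1 - normc w / s)^-1 by ring.
  have -> : 2 * B / s ^+ n.+1 * normc w ^+ n.+1 = (B * normc w ^+ n.+1 / s ^+ n.+1) * 2 by ring.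
  rewrite ler_wpM2l// !mulr_ge0 ?exprn_ge0 ?invr_ge0 ?normc_ge0//.
  by rewrite exprn_ge0// ltW.
have : normc (c n * w ^+ n) <= D * normc w ^+ n.+1.
  have := climitB (climit_cst (c n * w ^+ n)) cfw; rewrite subr0 => lim1.
  exact: climit_le lim1 tail.
rewrite normcM normcX exprS mulrA ler_pM2r ?exprn_gt0//.
apply/negP; rewrite -ltNge.
rewrite (le_lt_trans (y := normc w * (D + 1)))//; last by rewrite -ltr_pdivlMr// ltr_wpDl.
by rewrite mulrC ler_wpM2l// ?lerDl// ltW.
Qed.

(** Multiplying by [(z - z0) ^+ N] turns a Laurent expansion into a power
series. *)
Lemma laurentP f z0 N c : laurent_expansion f z0 N c <->
  exists2 e : R, 0 < e & forall z, z != z0 -> normc (z - z0) < e ->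
   climit (fun m => \sum_(0 <= n < m) c n * (z - z0) ^+ n) (f z * (z - z0) ^+ N).
Proof.
rewrite /laurent_expansion dnbhscP.
have termE z n : z != z0 ->
    c n * (z - z0) ^ (n%:Z - N%:Z) = ((z - z0) ^+ N)^-1 * (c n * (z - z0) ^+ n).
  move=> zz0; have zN : (z - z0) != 0 by rewrite subr_eq0.
  by rewrite expfzDr// -exprnP -invr_expz; ring.
split=> -[e e0 he]; exists e => // z zz0 ze.
  have /climitP/(climitZ ((z - z0) ^+ N)) := he z zz0 ze.
  rewrite mulrC; apply: climit_ext; exists 0%N => m _.
  rewrite mulr_sumr; apply: eq_bigr => i _; rewrite termE// mulrA divff ?mul1r//.
  by rewrite expf_neq0// subr_eq0.
apply/climitP; have /(climitZ (((z - z0) ^+ N)^-1)) := he z zz0 ze.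
rewrite mulrC -mulrA divff ?mulr1 ?expf_neq0 ?subr_eq0//.
apply: climit_ext; exists 0%N => m _.
by rewrite mulr_sumr; apply: eq_bigr => i _; rewrite termE.
Qed.

Definition eq_near f g z0 : Prop := exists2 e : R, 0 < e &
  forall z, z != z0 -> normc (z - z0) < e -> f z = g z.

Lemma laurent_eq f g z0 N c : eq_near f g z0 ->
  laurent_expansion f z0 N c -> laurent_expansion g z0 N c.
Proof.
move=> [e e0 fg] /laurentP[e' e'0 h]; apply/laurentP.
exists (Num.min e e'); first by rewrite lt_min e0.
move=> z zz0; rewrite lt_min => /andP[ze ze'].
by rewrite -(fg z zz0 ze); exact: h.
Qed.

(** Padding with [k] zero coefficients changes the order of the pole allowed for;
this is how expansions with different [N] are compared and added. *)
Lemma laurent_shift f z0 N k c : laurent_expansion f z0 N c ->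
  laurent_expansion f z0 (k + N) (fun n => if (n < k)%N then 0 else c (n - k)%N).
Proof.
move=> /laurentP[e e0 he]; apply/laurentP; exists e => // z zz0 /(he z zz0).
rewrite exprD mulrCA => /(climitZ ((z - z0) ^+ k)) h r /h[M hM].
exists (M + k)%N => m Mm; have km : (k <= m)%N by lia.
have {}hM : normc ((z - z0) ^+ k * (f z * (z - z0) ^+ N) -
    (z - z0) ^+ k * \sum_(0 <= n < m - k) c n * (z - z0) ^+ n) < r.
  by apply: hM; lia.
rewrite (big_cat_nat (leq0n k))//= big_nat big1 ?add0r; last first.
  by move=> i /andP[_ ->]; rewrite mul0r.
rewrite -[X in \sum_(X <= _ < _) _]add0n big_addn.
rewrite (eq_bigr (fun i => (z - z0) ^+ k * (c i * (z - z0) ^+ i))).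
  by rewrite -mulr_sumr.
by move=> i _; rewrite ltnNge leq_addl/= addnK exprD; ring.
Qed.

Lemma laurentD f g z0 N c d : laurent_expansion f z0 N c ->
    laurent_expansion g z0 N d ->
  laurent_expansion (fun z => f z + g z) z0 N (fun n => c n + d n).
Proof.
move=> /laurentP[e1 e10 h1] /laurentP[e2 e20 h2]; apply/laurentP.
exists (Num.min e1 e2); first by rewrite lt_min e10.
move=> z zz0; rewrite lt_min => /andP[/(h1 z zz0) {}h1 /(h2 z zz0) {}h2].
rewrite mulrDl; apply: climit_ext (climitD h1 h2); exists 0%N => m _ /=.
by rewrite -big_split/=; apply: eq_bigr => i _; rewrite mulrDl.
Qed.

Lemma laurentZ f z0 N c b : laurent_expansion f z0 N c ->
  laurent_expansion (fun z => b * f z) z0 N (fun n => b * c n).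
Proof.
move=> /laurentP[e e0 h]; apply/laurentP; exists e => // z zz0 /(h z zz0).
move=> /(climitZ b); rewrite mulrA.
apply: climit_ext; exists 0%N => m _ /=.
by rewrite mulr_sumr; apply: eq_bigr => i _; rewrite mulrA.
Qed.

Lemma laurent_zero f z0 N c : laurent_expansion f z0 N c ->
    (forall r : R, 0 < r -> exists z, [/\ z != z0, normc (z - z0) < r & f z = 0]) ->
  (forall n, c n = 0) /\ eq_near f (fun=> 0) z0.
Proof.
move=> /laurentP[e e0 he] zf.
have c0 : forall n, c n = 0.
  apply: (@power_series_zero c (fun w => f (w + z0) * w ^+ N) e e0).
    move=> w w0 we; have := he (w + z0); rewrite addrK; apply => //.
    by rewrite -subr_eq0 addrK.
  move=> r /zf[z [zz0 zr fz]]; exists (z - z0); rewrite subr_eq0; split=> //.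
  by rewrite subrK fz mul0r.
split=> //; exists e => // z zz0 ze.
suff /eqP : f z * (z - z0) ^+ N = 0.
  by rewrite mulf_eq0 (negPf (expf_neq0 _ _)) ?subr_eq0// orbF => /eqP.
apply: climit_unique (he z zz0 ze) _.
apply: climit_ext (climit_cst 0); exists 0%N => m _.
by rewrite big1// => i _; rewrite c0 mul0r.
Qed.


Definition meromorphic_at f z0 := exists N c, laurent_expansion f z0 N c.

Lemma laurent_uniq f z0 N M c d : laurent_expansion f z0 N c ->
    laurent_expansion f z0 M d ->
  forall n, (if (n < M)%N then 0 else c (n - M)%N) =
            (if (n < N)%N then 0 else d (n - N)%N).
Proof.
move=> /(laurent_shift M) h1 /(laurent_shift N) h2 n.
rewrite addnC in h1.
have := laurentD h1 (laurentZ (-1) h2) => /laurent_zero[].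
  move=> r r0; have r20 : 0 < r / 2 by rewrite divr_gt0.
  have nr : normc (r / 2)%:C = r / 2 by rewrite normc_real gtr0_norm.
  exists (z0 + (r / 2)%:C); split; last by rewrite mulN1r subrr.
    by rewrite -subr_eq0 addrC addKr -normc_gt0 nr.
  by rewrite addrC addKr nr; lra.
by move=> /(_ n)/eqP; rewrite mulN1r subr_eq0 => /eqP.
Qed.

Lemma is_residue_uniq f z0 x y : is_residue f z0 x -> is_residue f z0 y -> x = y.
Proof.
move=> [N [c [cf ->]]] [M [d [df ->]]].
have := laurent_uniq cf df (N + M.+1)%N.
rewrite !ifF; try lia.
have -> : (N + M.+1 - M.+1 = N)%N by lia.
by have -> : (N + M.+1 - N.+1 = M)%N by lia.
Qed.

Lemma residueE f z0 x : is_residue f z0 x -> residue f z0 = x.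
Proof.
move=> fx; have : is_residue f z0 (residue f z0).
  rewrite /residue; case: xgetP => [y _ //|/(_ x)/=/(_ fx)//].
by move/is_residue_uniq; apply.
Qed.

Lemma is_residue_laurent0 f z0 c : laurent_expansion f z0 0 c -> is_residue f z0 0.
Proof. by move=> /(laurent_shift 1) h; exists 0%N; eexists; split; first exact: h. Qed.

Lemma is_residueD f g z0 x y : is_residue f z0 x -> is_residue g z0 y ->
  is_residue (fun z => f z + g z) z0 (x + y).
Proof.
move=> [N [c [cf ->]]] [M [d [df ->]]].
have := laurentD (laurent_shift M.+1 cf)
  (eq_ind _ (fun k => laurent_expansion g z0 k _) (laurent_shift N.+1 df) _ (addnC _ _)).
rewrite addSn => h; exists (M + N.+1)%N; eexists; split; first exact: h.
rewrite /= !ifF; [|by lia..].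
have -> : (M + N.+1 - M.+1 = N)%N by lia.
by have -> : (M + N.+1 - N.+1 = M)%N by lia.
Qed.

Lemma is_residue_eq f g z0 x : eq_near f g z0 ->
  is_residue f z0 x -> is_residue g z0 x.
Proof. by move=> fg [N [c [fc ->]]]; exists N, c; split; first exact: laurent_eq fg fc. Qed.

Lemma meromorphic_atB f g z0 : meromorphic_at f z0 -> meromorphic_at g z0 ->
  meromorphic_at (fun z => f z - g z) z0.
Proof.
move=> [N [c /(laurent_shift _) cf]] [M [d /(laurent_shift N) df]].
have {}cf := cf M; rewrite addnC in cf.
have h := laurentD cf (laurentZ (-1) df).
exists (N + M)%N; eexists; apply: laurent_eq h.
by exists 1 => // z _ _; rewrite mulN1r.
Qed.

Lemma meromorphic_at_eq f g z0 : eq_near f g z0 ->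
  meromorphic_at f z0 -> meromorphic_at g z0.
Proof. by move=> fg [N [c cf]]; exists N, c; exact: laurent_eq fg cf. Qed.

(** The points near which [f] and [g] agree form a set that is open, and closed
because zeros of a Laurent series cannot accumulate at its centre; so this set
contains the whole segment. *)
Lemma identity_segment f g z :
    (forall t : R, 0 <= t <= 1 -> meromorphic_at f (t%:C * z)) ->
    (forall t : R, 0 <= t <= 1 -> meromorphic_at g (t%:C * z)) ->
    eq_near f g 0 ->
  eq_near f g z.
Proof.
move=> fm gm fg0.
pose Z (t : R) := eq_near f g (t%:C * z).
suff : `[0, 1]%classic `&` Z = `[0 : R, 1]%classic.
  move/seteqP => [_ /(_ 1)]; rewrite /= in_itv/= ler01 lexx => /(_ isT)[_].
  by rewrite /Z mul1r.
have [z00|z0] := eqVneq z 0.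
  apply/seteqP; split => [t [t01 _]|t t01]; first exact: t01.
  split; first exact: t01.
  by rewrite /Z z00 mulr0.
have nz0 : 0 < normc z by rewrite normc_gt0.
have dist (t u : R) : normc (t%:C * z - u%:C * z) = `|t - u| * normc z.
  by rewrite -mulrBl -rmorphB normcM normc_real.
(* a point of the punctured neighbourhood of [q] that avoids [p] *)
have punctured (p q : C) (e : R) : 0 < e -> exists w,
    [/\ w != p, w != q & normc (w - q) < e].
  move=> e0.
  have [w [wq we]] : exists x : R, 0 < x < e /\ q + x%:C != p.
    have [h|h] := eqVneq (q + (e / 2)%:C) p; last first.
      by exists (e / 2); split=> //; apply/andP; split; lra.
    exists (e / 3); split; first by apply/andP; split; lra.
    rewrite -h (inj_eq (addrI _)) eq_complex /= eqxx andbT.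
    by apply/eqP; lra.
  exists (q + w%:C); split=> //.
    rewrite -subr_eq0 addrC addKr -normc_gt0 normc_real gtr0_norm; lra.
  by rewrite addrC addKr normc_real gtr0_norm; lra.
apply: (@segment_connected R 0 1).
- exists 0; split; first by rewrite /= in_itv/= lexx ler01.
  by rewrite /Z mul0r.
- exists Z; last by [].
  rewrite openE => t [e e0 he].
  apply/nbhs_ballP; exists (e / normc z); first exact: divr_gt0.
  move=> u; rewrite /ball/= => tu.
  have [->|ut] := eqVneq u t; first by exists e.
  have ut0 : 0 < `|u - t| * normc z by rewrite mulr_gt0// normr_gt0 subr_eq0.
  exists (Num.min (`|u - t| * normc z) (e - `|u - t| * normc z)).
    by rewrite lt_min ut0 subr_gt0 -ltr_pdivlMr// distrC.
  move=> w wu; rewrite lt_min -!dist => /andP[w1 w2]; apply: he.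
    by apply: contraTneq w1 => ->; rewrite normcB ltxx.
  have := le_normcD (w - u%:C * z) (u%:C * z - t%:C * z).
  by rewrite addrA subrK => h; lra.
exists (`[0, 1]%classic `&` Z); last by rewrite setIA setIid.
have : closed (`[0 : R, 1]%classic) by exact: interval_closed.
move=> c01 t tc; have t01 : `[0 : R, 1]%classic t.
  by apply: c01; apply: closureS tc => u [].
split; first exact: t01.
move: (t01); rewrite /= in_itv/= => t01'.
have [N [c hc]] := meromorphic_atB (fm t t01') (gm t t01').
have [] := laurent_zero hc; last first.
  by move=> _ [e e0 he]; exists e => // w w1 w2; apply/eqP; rewrite -subr_eq0 he.
move=> r r0.
have r2z : 0 < r / 2 / normc z by rewrite !divr_gt0.
have [u [[_ Zu] tu]] := tc _ (nbhsx_ballx t _ r2z).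
have {}tu : `|u - t| * normc z < r / 2 by rewrite -ltr_pdivlMr// distrC.
move: Zu => [e e0 he].
have [|w [w1 w2 w3]] := punctured (t%:C * z) (u%:C * z) (Num.min e (r / 2)).
  by rewrite lt_min e0 divr_gt0.
move: w3; rewrite lt_min => /andP[we wr]; exists w; split=> //.
  have := le_normcD (w - u%:C * z) (u%:C * z - t%:C * z).
  by rewrite addrA subrK dist => ?; lra.
by rewrite he ?subrr.
Qed.

End PowerSeries.

(** * Power series and geometric series as Laurent expansions *)

Section Blocks.
Variable R : realType.
Local Notation C := R[i].
Implicit Types (z w l : C) (u v c d : nat -> C) (f g : C -> C).

Lemma climit_sum (K : nat) (F : nat -> nat -> C) (l : nat -> C) :
    (forall k, climit (F k) (l k)) ->
  climit (fun m => \sum_(0 <= k < K) F k m) (\sum_(0 <= k < K) l k).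
Proof.
move=> h; elim: K => [|K IH].
  rewrite big_geq//; apply: climit_ext (climit_cst 0); exists 0%N => n _.
  by rewrite big_geq.
rewrite big_nat_recr//=; apply: climit_ext (climitD IH (h K)); exists 0%N => n _.
by rewrite big_nat_recr.
Qed.

Lemma climit_expr w : normc w < 1 -> climit (fun m => w ^+ m) 0.
Proof.
move=> w1; apply: (@climit_dominated _ _ _ (fun m => normc w ^+ m)).
  by move=> n; rewrite sub0r normcN normcX.
by apply: cvg_expr; rewrite ger0_norm ?normc_ge0.
Qed.

Definition psum v z : C :=
  xget 0 [set l | climit (fun m => \sum_(0 <= n < m) v n * z ^+ n) l].

Lemma psumP v (A q : R) z : 0 < q -> q * normc z < 1 ->
    (forall n, normc (v n) <= A * q ^+ n) ->
  climit (fun m => \sum_(0 <= n < m) v n * z ^+ n) (psum v z).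
Proof.
move=> q0 qz vb; rewrite /psum.
have [l hl] : exists l, climit (fun m => \sum_(0 <= n < m) v n * z ^+ n) l.
  apply: (@cvg_geometric_dominated _ _ A (q * normc z)) => //.
    by rewrite mulr_ge0 ?normc_ge0// ltW.
  move=> n; rewrite normcM normcX exprMn mulrA ler_wpM2r//.
  by rewrite exprn_ge0 ?normc_ge0.
by case: xgetP => [y _ //|/(_ l)].
Qed.

Lemma exprDn_extended (S : comNzRingType) (x y : S) n K :
  (x + y) ^+ n = \sum_(0 <= k < n.+1 + K) x ^+ (n - k) * y ^+ k *+ 'C(n, k).
Proof.
rewrite exprDn (big_cat_nat (leq0n n.+1)) ?leq_addr//= big_mkord.
rewrite [X in _ = _ + X](_ : _ = 0) ?addr0// big_nat big1// => k /andP[nk _].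
by rewrite bin_small.
Qed.

(** Doubling the increment [w] costs a factor [2 ^+ k] in the term of order
[k], which makes the tails of all binomial expansions small at a rate that does
not depend on [n]. *)
Lemma binomial_tail z w n K :
  normc ((z + w) ^+ n - \sum_(0 <= k < K) z ^+ (n - k) * w ^+ k *+ 'C(n, k)) <=
  2^-1 ^+ K * (normc z + 2 * normc w) ^+ n.
Proof.
rewrite (exprDn_extended z w n K) (big_cat_nat (leq0n K)) ?leq_addl//=.
rewrite [X in normc X <= _]addrAC subrr add0r (exprDn_extended (normc z) _ n K).
rewrite (big_cat_nat (leq0n K)) ?leq_addl//= mulrDr.
rewrite (le_trans (normc_sum _ _ _))// -[leLHS]add0r lerD//.
  rewrite mulr_ge0 ?exprn_ge0 ?invr_ge0 ?sumr_ge0// => i _.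
  by rewrite mulrn_wge0// mulr_ge0 ?exprn_ge0 ?mulr_ge0 ?normc_ge0.
rewrite mulr_sumr big_nat [leRHS]big_nat ler_sum// => k /andP[Kk _].
rewrite normcMn mulrnAr lerMn2r; apply/orP; right.
rewrite normcM !normcX exprMn mulrCA ler_wpM2l ?exprn_ge0 ?normc_ge0//.
rewrite mulrA ler_peMl ?exprn_ge0 ?normc_ge0//.
by rewrite exprVn mulrC ler_pdivlMr ?exprn_gt0// mul1r ler_eXn2l// ltr1n.
Qed.

(** The coefficients at [z0] are the sums over [n] of the coefficients of
[v n * (z0 + w) ^+ n]. No interchange of infinite sums is needed: by
[binomial_tail] the [K]-th partial sum of the expansion is within
[2^-1 ^+ K * \sum_n A * (q * (normc z0 + 2 * normc w)) ^+ n] of [psum v z]. *)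
Lemma laurent_psum v (A q : R) z0 : 0 < q -> q * normc z0 < 1 ->
    (forall n, normc (v n) <= A * q ^+ n) ->
  exists c, laurent_expansion (psum v) z0 0 c.
Proof.
move=> q0 qz vb.
have A0 : 0 <= A by have := vb 0%N; rewrite expr0 mulr1; apply/le_trans/normc_ge0.
(* a quarter of the distance to the circle of convergence leaves room for
   the factor 2 of [binomial_tail] *)
pose e : R := (q^-1 - normc z0) / 4.
have e0 : 0 < e by rewrite divr_gt0// subr_gt0 -[q^-1]mulr1 ltr_pdivlMl.
have qe (x : R) : x <= 2 * e -> q * (normc z0 + x) < 1.
  move=> xe; rewrite mulrC -ltr_pdivlMr// div1r.
  have : 4 * e = q^-1 - normc z0 by rewrite /e mulrC divfK.
  lra.
clearbody e; pose t k n := v n * (z0 ^+ (n - k) *+ 'C(n, k)).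
have /choice[c hc] : forall k, exists l, climit (fun m => \sum_(0 <= n < m) t k n) l.
  move=> k; apply: (@cvg_geometric_dominated _ _ (A / e ^+ k) (q * (normc z0 + e))).
  - by rewrite mulr_ge0 ?addr_ge0 ?normc_ge0// ltW.
  - by apply: qe; lra.
  move=> n; rewrite /t normcM normcMn normcX.
  have [nk|kn] := ltnP n k.
    rewrite bin_small// mulr0n mulr0 mulr_ge0 ?divr_ge0// ?exprn_ge0// ?(ltW e0)//.
    by rewrite mulr_ge0 ?addr_ge0 ?normc_ge0// ltW.
  have h : normc z0 ^+ (n - k) *+ 'C(n, k) <= (e ^+ k)^-1 * (normc z0 + e) ^+ n.
    rewrite mulrC ler_pdivlMr ?exprn_gt0// exprDn.
    have kn' : (k < n.+1)%N by [].
    rewrite (bigD1 (Ordinal kn'))//= mulrnAl lerDl sumr_ge0// => i _.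
    by rewrite mulrn_wge0// mulr_ge0 ?exprn_ge0 ?normc_ge0// ltW.
  have h0 : 0 <= normc z0 ^+ (n - k) *+ 'C(n, k).
    by rewrite mulrn_wge0// exprn_ge0// normc_ge0.
  rewrite (le_trans (ler_pM (normc_ge0 _) h0 (vb n) h))// exprMn.
  by rewrite le_eqVlt; apply/orP; left; apply/eqP; ring.
exists c; apply/laurentP; exists e => // z _ ze; rewrite expr0 mulr1.
pose w := z - z0; have zE : z = z0 + w by rewrite /w addrC subrK.
have qw : q * (normc z0 + 2 * normc w) < 1 by apply: qe; rewrite ler_pM2l// ltW.
pose B := A / (1 - q * (normc z0 + 2 * normc w)).
apply: (@climit_dominated _ _ _ (fun K => B * 2^-1 ^+ K)); last first.
  have -> : (0 : R) = B * 0 by rewrite mulr0.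
  apply: cvgM; first exact: cvg_cst.
  by apply: cvg_expr; rewrite ger0_norm ?invr_ge0// invf_lt1// ltr1n.
move=> K; apply: (@climit_le _ (fun m => \sum_(0 <= n < m) v n * z ^+ n -
    \sum_(0 <= k < K) w ^+ k * \sum_(0 <= n < m) t k n) _ _ 0).
  apply: climitB.
    apply: (psumP q0 _ vb); apply: le_lt_trans qw.
    rewrite ler_pM2l// zE (le_trans (le_normcD _ _))// lerD2l.
    by rewrite ler_peMl ?normc_ge0// ler1n.
  under [X in climit _ X]eq_bigr do rewrite mulrC.
  by apply: climit_sum => k; exact: climitZ.
move=> m _.
rewrite (_ : _ - _ = \sum_(0 <= n < m) v n *
   (z ^+ n - \sum_(0 <= k < K) z0 ^+ (n - k) * w ^+ k *+ 'C(n, k))); last first.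
  under [X in _ - X]eq_bigr do rewrite mulr_sumr.
  rewrite exchange_big/= -sumrB; apply: eq_bigr => n _.
  rewrite mulrBr; congr (_ - _); rewrite mulr_sumr; apply: eq_bigr => k _.
  rewrite /t -mulrnAl; move: (z0 ^+ (n - k) *+ 'C(n, k)) (w ^+ k) (v n) => x y t0; ring.
rewrite (le_trans (normc_sum _ _ _))//.
apply: (@le_trans _ _ (\sum_(0 <= n < m) A * 2^-1 ^+ K * (q * (normc z0 + 2 * normc w)) ^+ n)).
  apply: ler_sum => n _; rewrite normcM exprMn.
  have h := binomial_tail z0 w n K; rewrite -zE in h.
  rewrite (le_trans (ler_pM (normc_ge0 _) (normc_ge0 _) (vb n) h))//.
  by rewrite le_eqVlt; apply/orP; left; apply/eqP; ring.
rewrite -mulr_sumr /B [leRHS]mulrAC ler_wpM2l ?mulr_ge0 ?exprn_ge0 ?invr_ge0//.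
rewrite (le_trans (sum_geometric_le _ _ _ qw)) ?expr0 ?div1r//.
by rewrite mulr_ge0 ?addr_ge0 ?mulr_ge0 ?normc_ge0// ltW.
Qed.

Definition geo_block y b z : C := y * b * z / (1 - b * z).

Lemma geo_blockE y b z : b * z != 1 -> geo_block y b z = - y + y / (1 - b * z).
Proof.
move=> bz; have h : 1 - b * z != 0 by rewrite subr_eq0 eq_sym.
by rewrite /geo_block; field.
Qed.

Lemma sum_expr_closed w m : w != 1 ->
  \sum_(0 <= n < m) w ^+ n = (1 - w ^+ m) / (1 - w).
Proof.
move=> w1; have h : 1 - w != 0 by rewrite subr_eq0 eq_sym.
elim: m => [|m IH]; first by rewrite big_geq// expr0 subrr mul0r.
by rewrite big_nat_recr//= IH exprS; field.
Qed.

Lemma normc_lt1_neq1 w : normc w < 1 -> w != 1.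
Proof. by apply: contraTneq => ->; rewrite normc1 ltxx. Qed.

Lemma geo_block_series y b z : normc (b * z) < 1 ->
  climit (fun m => \sum_(1 <= n < m) y * b ^+ n * z ^+ n) (geo_block y b z).
Proof.
move=> bz1; have bz := normc_lt1_neq1 bz1.
rewrite geo_blockE//.
have h : climit (fun m => - y + y / (1 - b * z) * (1 - (b * z) ^+ m))
    (- y + y / (1 - b * z) * (1 - 0)).
  apply: climitD; first exact: climit_cst.
  apply: climitZ; apply: climitB; first exact: climit_cst.
  exact: climit_expr.
rewrite subr0 mulr1 in h; apply: climit_ext h; exists 1%N => m m0.
transitivity (- y + y * \sum_(0 <= n < m) (b * z) ^+ n).
  by rewrite sum_expr_closed//; congr (_ + _); rewrite -mulrA; congr (_ * _); rewrite mulrC.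
rewrite big_ltn// expr0 mulrDr mulr1 addKr mulr_sumr.
by apply: eq_bigr => i _; rewrite exprMn mulrA.
Qed.

Lemma laurent_cst y z0 :
  laurent_expansion (fun=> y) z0 0 (fun k => if k is 0%N then y else 0).
Proof.
apply/laurentP; exists 1 => // z _ _; rewrite expr0 mulr1.
apply: climit_ext (climit_cst y); exists 1%N => m m0.
rewrite big_ltn// expr0 mulr1 [X in _ + X](_ : _ = 0) ?addr0// big_nat.
by rewrite big1// => -[|i]// _; rewrite mul0r.
Qed.

Lemma laurent_geo_block y b z0 : b * z0 != 1 ->
  exists c, laurent_expansion (geo_block y b) z0 0 c.
Proof.
move=> bz0; have d0 : 1 - b * z0 != 0 by rewrite subr_eq0 eq_sym.
pose e : R := normc (1 - b * z0) / (normc b + 1).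
have b1 : 0 < normc b + 1 by rewrite ltr_wpDl// normc_ge0.
have e0 : 0 < e by rewrite divr_gt0// normc_gt0.
have small z : normc (z - z0) < e -> normc (b * (z - z0) / (1 - b * z0)) < 1.
  move=> ze; rewrite normcM normcV ltr_pdivrMr ?normc_gt0// mul1r normcM.
  move: ze; rewrite /e ltr_pdivlMr// mulrDr mulr1; apply: le_lt_trans.
  by rewrite mulrC lerDl normc_ge0.
have dE z : (1 - b * z0) * (1 - b * (z - z0) / (1 - b * z0)) = 1 - b * z by field.
have bz z : normc (z - z0) < e -> b * z != 1.
  move=> /small/normc_lt1_neq1 h; rewrite eq_sym -subr_eq0 -dE mulf_neq0//.
  by rewrite subr_eq0 eq_sym.
have inv : laurent_expansion (fun z => y / (1 - b * z)) z0 0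
    (fun k => y * b ^+ k / (1 - b * z0) ^+ k.+1).
  apply/laurentP; exists e => // z _ ze; rewrite expr0 mulr1.
  have xs := small z ze; set x := (b * (z - z0) / (1 - b * z0)) in xs *.
  have h : climit (fun m => y / (1 - b * z) * (1 - x ^+ m)) (y / (1 - b * z) * (1 - 0)).
    apply: climitZ; apply: climitB; first exact: climit_cst.
    exact: climit_expr.
  rewrite subr0 mulr1 in h; apply: climit_ext h; exists 0%N => m _.
  transitivity (y / (1 - b * z0) * \sum_(0 <= n < m) x ^+ n).
    rewrite sum_expr_closed ?normc_lt1_neq1// -dE -/x invfM.
    have h : 1 - x != 0 by rewrite subr_eq0 eq_sym normc_lt1_neq1.
    by field; rewrite h d0.
  rewrite mulr_sumr; apply: eq_bigr => i _; rewrite /x !exprMn exprVn exprS.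
  by field; rewrite expf_neq0// d0.
exists (fun k => (if k is 0%N then - y else 0) + y * b ^+ k / (1 - b * z0) ^+ k.+1).
apply: laurent_eq (laurentD (laurent_cst (- y) z0) inv).
by exists e => // z _ ze; rewrite geo_blockE ?bz.
Qed.

Lemma residue_geo_block y b z0 : is_residue (geo_block y b) z0
  (if b * z0 == 1 then - (z0 * y) else 0).
Proof.
case: eqVneq => [bz0|/(laurent_geo_block y)[c /is_residue_laurent0]//].
exists 0%N, (fun k => if k is 0%N then - (z0 * y) else if k is 1%N then - y else 0).
split; last by [].
apply/laurentP; exists 1 => // z zz0 _; rewrite expr1.
have b0 : b != 0 by apply: contra_eq_neq bz0 => ->; rewrite mul0r eq_sym oner_eq0.
have h : geo_block y b z * (z - z0) = - (z0 * y) - y * (z - z0).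
  have nz : 1 - b * z != 0.
    rewrite subr_eq0 eq_sym; apply: contra zz0 => /eqP bz.
    by apply/eqP/(mulfI b0); rewrite bz bz0.
  have -> : z0 = b^-1 by apply: (mulfI b0); rewrite bz0 divff.
  by rewrite /geo_block; field; rewrite nz b0.
rewrite h; apply: climit_ext (climit_cst _); exists 2%N => -[|[|m]]// _.
rewrite big_ltn// big_ltn// expr0 mulr1 expr1 [X in _ + (_ + X)](_ : _ = 0) ?addr0 ?mulNr// big_nat.
by rewrite big1// => -[|[|i]]// _; rewrite mul0r.
Qed.

End Blocks.

(** * Continuation from exponential expansions *)

Section Continuation.
Variable R : realType.
Local Notation C := R[i].
Implicit Types (z w l : C) (u v c d : nat -> C) (f g : C -> C) (L : seq (C * C)).
Implicit Types (rho sigma : R).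

(** A pair [(c, b)] in [L] stands for the sequence [c b^n]. The bound on the error
makes its generating series converge beyond the disc of radius [sigma], and the
condition on [rho] makes the geometric series of [L] converge on the disc of
radius [rho], where the series of [u] itself is considered. *)
Definition expansion u rho sigma L : Prop := exists A q : R,
  [/\ 0 < q, q * sigma < 1,
      forall n, (1 <= n)%N -> normc (u n - \sum_(p <- L) p.1 * p.2 ^+ n) <= A * q ^+ n &
      forall p, p \in L -> normc p.2 * rho <= 1].

Definition remainder u L n : C :=
  if n is 0%N then 0 else u n - \sum_(p <- L) p.1 * p.2 ^+ n.

Definition expansion_sum u L z : C :=
  \sum_(p <- L) geo_block p.1 p.2 z + psum (remainder u L) z.

(** The blocks of [L] with a pole at [z0] are those with [p.2 * z0 = 1], and each
contributes [- z0 * p.1] to the residue. *)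
Definition residue_coef L z0 : C := - z0 * \sum_(p <- L | p.2 * z0 == 1) p.1.

Lemma remainder_bound u rho sigma L : expansion u rho sigma L ->
  exists A q : R, [/\ 0 < q, q * sigma < 1 &
    forall n, normc (remainder u L n) <= A * q ^+ n].
Proof.
move=> [A [q [q0 qs ub _]]]; exists A, q; split=> // -[|n]; last exact: ub.
rewrite /remainder normc0 expr0 mulr1.
by rewrite -(pmulr_lge0 _ (exprn_gt0 1 q0)) (le_trans (normc_ge0 _) (ub 1%N _)).
Qed.

Lemma is_residue0 z0 : is_residue (fun=> 0 : C) z0 0.
Proof. exact: is_residue_laurent0 (laurent_cst 0 z0). Qed.

Lemma expansion_sum_residue u rho sigma L z0 : expansion u rho sigma L ->
  normc z0 < sigma -> is_residue (expansion_sum u L) z0 (residue_coef L z0).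
Proof.
move=> /remainder_bound[A [q [q0 qs ub]]] zs.
have qz : q * normc z0 < 1.
  by apply: le_lt_trans qs; rewrite ler_pM2l// ltW.
have [c /is_residue_laurent0 h] := laurent_psum q0 qz ub.
rewrite -[residue_coef L z0]addr0; apply: is_residueD h.
rewrite /residue_coef big_mkcond mulr_sumr.
elim: L {ub} => [|p L IH].
  rewrite big_nil; apply: is_residue_eq (is_residue0 z0).
  by exists 1 => // z _ _; rewrite big_nil.
rewrite big_cons; have := is_residueD (residue_geo_block p.1 p.2 z0) IH.
rewrite [if _ then - _ else _](_ : _ = - z0 * if p.2 * z0 == 1 then p.1 else 0).
  by apply: is_residue_eq; exists 1 => // z _ _; rewrite big_cons.
case: ifP => _; first by rewrite mulNr.
by rewrite mulr0.
Qed.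

Lemma expansion_sum_laurent0 u rho sigma L z0 : expansion u rho sigma L ->
    normc z0 < sigma -> (forall p, p \in L -> p.2 * z0 != 1) ->
  exists c, laurent_expansion (expansion_sum u L) z0 0 c.
Proof.
move=> /remainder_bound[A [q [q0 qs ub]]] zs pL.
have qz : q * normc z0 < 1.
  by apply: le_lt_trans qs; rewrite ler_pM2l// ltW.
have [c h] := laurent_psum q0 qz ub.
suff [d h'] : exists d, laurent_expansion (fun z => \sum_(p <- L) geo_block p.1 p.2 z) z0 0 d.
  by eexists; exact: laurentD h' h.
elim: L pL {ub h} => [|p L IH] pL.
  eexists; apply: laurent_eq (laurent_cst 0 z0).
  by exists 1 => // z _ _; rewrite big_nil.
have [|d hd] := IH; first by move=> p' p'L; apply: pL; rewrite inE p'L orbT.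
have [|c' hc'] := @laurent_geo_block _ p.1 p.2 z0.
  by apply: pL; rewrite inE eqxx.
eexists; apply: laurent_eq (laurentD hc' hd).
by exists 1 => // z _ _; rewrite big_cons.
Qed.

Lemma is_residue_meromorphic f z0 x : is_residue f z0 x -> meromorphic_at f z0.
Proof. by move=> [N [c [h _]]]; exists N.+1, c. Qed.

Lemma expansion_sum_series u rho sigma L z : expansion u rho sigma L ->
    normc z < rho -> normc z < sigma ->
  climit (fun m => \sum_(1 <= n < m) u n * z ^+ n) (expansion_sum u L z).
Proof.
move=> Lu zr zs; have [A [q [q0 qs ub]]] := remainder_bound Lu.
have qz : q * normc z < 1.
  by apply: le_lt_trans qs; rewrite ler_pM2l// ltW.
have h := psumP q0 qz ub.
have hL : climit (fun m => \sum_(p <- L) \sum_(1 <= n < m) p.1 * p.2 ^+ n * z ^+ n)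
    (\sum_(p <- L) geo_block p.1 p.2 z).
  have [_ [_ [_ _ _ Lrho]]] := Lu.
  elim: L Lrho {Lu ub h} => [|p L IH] Lrho.
    rewrite big_nil; apply: climit_ext (climit_cst 0); exists 0%N => n _.
    by rewrite big_nil.
  have hi : climit (fun m => \sum_(1 <= n < m) p.1 * p.2 ^+ n * z ^+ n) (geo_block p.1 p.2 z).
    apply: geo_block_series; rewrite normcM.
    have := Lrho p; rewrite inE eqxx => /(_ isT).
    have [->|p0] := eqVneq p.2 0; first by rewrite normc0 !mul0r.
    by apply: lt_le_trans; rewrite ltr_pM2l// normc_gt0.
  have hs := IH (fun p' p'L => Lrho p' (mem_behead (s := p :: L) p'L)).
  rewrite big_cons; apply: climit_ext (climitD hi hs); exists 0%N => n _.
  by rewrite big_cons.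
apply: climit_ext (climitD hL h); exists 1%N => m m0.
rewrite [X in _ + X]big_ltn// /remainder mul0r add0r exchange_big/= -big_split/=.
rewrite !big_nat; apply: eq_bigr => -[|n]//= _.
by rewrite mulrBl mulr_suml addrC subrK.
Qed.

(** Both sums equal the series near 0, and they are meromorphic along the segment
from 0 to [z0]. *)
Lemma expansion_sum_agree u rho s1 s2 L1 L2 z0 : 0 < rho ->
    expansion u rho s1 L1 -> expansion u rho s2 L2 ->
    normc z0 < s1 -> normc z0 < s2 ->
  eq_near (expansion_sum u L1) (expansion_sum u L2) z0.
Proof.
move=> r0 h1 h2 z1 z2.
have n0 := normc_ge0 z0.
have tz (t : R) : 0 <= t <= 1 -> normc (t%:C * z0) <= normc z0.
  by move=> /andP[t0 t1]; rewrite normcM normc_real ger0_norm// ler_piMl.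
apply: identity_segment.
- move=> t /tz t01; apply: is_residue_meromorphic; apply: expansion_sum_residue h1 _.
  exact: le_lt_trans z1.
- move=> t /tz t01; apply: is_residue_meromorphic; apply: expansion_sum_residue h2 _.
  exact: le_lt_trans z2.
exists (Num.min rho (Num.min s1 s2)); first by rewrite !lt_min r0 !(le_lt_trans n0).
move=> z _; rewrite subr0 !lt_min => /and3P[zr zs1 zs2].
apply: climit_unique (expansion_sum_series h1 zr zs1) _.
exact: expansion_sum_series h2 zr zs2.
Qed.

(** At [z] the expansion for the radius [t z + 2] is used, [t z] being the integer
part of [normc z]. Near [z0] only the expansions of radius [t z0 + 1] and
[t z0 + 2] occur, and [z0] lies inside both discs, so they agree there. *)
Lemma continuation_exists u rho : 0 < rho ->
    (forall sigma, 0 < sigma -> exists L, expansion u rho sigma L) ->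
  exists g, continues_series u rho%:C g.
Proof.
move=> r0 hL.
have /choice[Lf hf] : forall M : nat, exists L, expansion u rho M.+1%:R L.
  by move=> M; apply: hL.
pose H M := expansion_sum u (Lf M).
pose t z := Num.truncn (normc z).
have tP z : (t z)%:R <= normc z < (t z).+1%:R.
  by apply: truncn_itv; exact: normc_ge0.
exists (fun z => H (t z).+1 z); split=> [z0|z].
  have /andP[tz1 tz2] := tP z0.
  have H1 : is_residue (H (t z0).+1) z0 (residue_coef (Lf (t z0).+1) z0).
    apply: expansion_sum_residue (hf _) _.
    by rewrite (lt_trans tz2)// ltr_nat.
  apply: meromorphic_at_eq (is_residue_meromorphic H1).
  have [e e0 he] : eq_near (H (t z0)) (H (t z0).+1) z0.
    apply: expansion_sum_agree (hf _) (hf _) _ _ => //.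
    by rewrite (lt_trans tz2)// ltr_nat.
  exists (Num.min e (Num.min 1 ((t z0).+1%:R - normc z0))).
    by rewrite !lt_min e0 ltr01 subr_gt0.
  move=> z zz0; rewrite !lt_min => /and3P[ze z1 z2].
  have d1 := le_normcD (z - z0) z0; rewrite subrK in d1.
  have d2 := le_normcD (z0 - z) z; rewrite subrK (normcB z0) in d2.
  have /andP[tz3 tz4] := tP z.
  have : (t z < (t z0).+1)%N by rewrite -(ltr_nat R); lra.
  have : (t z0 < (t z).+2)%N.
    by rewrite -(ltr_nat R) -[(t z).+2]addn1 natrD; lra.
  move=> a1 a2; have [->//|tt] := eqVneq (t z) (t z0).
  have -> : (t z).+1 = t z0 by move: a1 a2 tt; clear; lia.
  by rewrite (he z zz0 ze).
rewrite norm_normc ltcR => zr; apply/climitP.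
have /andP[_ tz] := tP z.
by apply: expansion_sum_series (hf _) zr _; rewrite (lt_trans tz)// ltr_nat.
Qed.

Lemma continuation_agree u rho sigma L z0 : 0 < rho ->
    (forall sigma, 0 < sigma -> exists L, expansion u rho sigma L) ->
    expansion u rho sigma L -> normc z0 < sigma ->
  eq_near (expansion_sum u L) (meromorphic_continuation u rho%:C) z0.
Proof.
move=> r0 hL h zs; set G := meromorphic_continuation u rho%:C.
have [mG sG] : continues_series u rho%:C G.
  rewrite /G /meromorphic_continuation; have [g hg] := continuation_exists r0 hL.
  by case: xgetP => [y _ //|/(_ g)].
apply: identity_segment.
- move=> t /andP[t0 t1]; apply: is_residue_meromorphic; apply: expansion_sum_residue h _.
  apply: le_lt_trans zs.
  by rewrite normcM normc_real ger0_norm// ler_piMl// normc_ge0.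
- by move=> t _; exact: mG.
have n0 := normc_ge0 z0.
exists (Num.min rho sigma); first by rewrite lt_min r0 (le_lt_trans n0).
move=> z _; rewrite subr0 lt_min => /andP[zr zs1].
apply: climit_unique (expansion_sum_series h zr zs1) _.
by apply/climitP/sG; rewrite norm_normc ltcR.
Qed.

Lemma continuation_residue u rho sigma L z0 : 0 < rho ->
    (forall sigma, 0 < sigma -> exists L, expansion u rho sigma L) ->
    expansion u rho sigma L -> normc z0 < sigma ->
  residue (meromorphic_continuation u rho%:C) z0 = residue_coef L z0.
Proof.
move=> r0 hL h zs; apply: residueE.
exact: is_residue_eq (continuation_agree r0 hL h zs) (expansion_sum_residue h zs).
Qed.

(** The series is analytic at 0. *)
Lemma continuation_pole u rho z0 : 0 < rho ->
    (forall sigma, 0 < sigma -> exists L, expansion u rho sigma L) ->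
  pole (meromorphic_continuation u rho%:C) z0 -> z0 != 0.
Proof.
move=> r0 hL [N [c [N0 hc c0]]]; apply: contra_neq c0 => z00.
have [L h] := hL 1 ltr01; rewrite z00 in hc.
have n01 : normc (0 : C) < 1 by rewrite normc0.
have [|d hd] := expansion_sum_laurent0 h n01.
  by move=> p _; rewrite mulr0 eq_sym oner_eq0.
have := laurent_uniq hc (laurent_eq (continuation_agree r0 hL h n01) hd) 0.
by rewrite ltnn subn0 N0.
Qed.

End Continuation.

(** * Complex powers and the binomial series *)

Section ComplexPowers.
Variable R : realType.
Local Notation C := R[i].
Implicit Types (t x : R) (y z : C).

Lemma ReM_real y t : complex.Re (y * t%:C) = complex.Re y * t.
Proof. by case: y => a b /=; rewrite mulr0 subr0. Qed.

Lemma ImM_real y t : complex.Im (y * t%:C) = complex.Im y * t.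
Proof. by case: y => a b /=; rewrite mulr0 add0r. Qed.

Lemma ReD y z : complex.Re (y + z) = complex.Re y + complex.Re z.
Proof. by case: y z => [? ?] [? ?]. Qed.

Lemma ImD y z : complex.Im (y + z) = complex.Im y + complex.Im z.
Proof. by case: y z => [? ?] [? ?]. Qed.

Lemma cpowD t y z : 0 < t -> cpow t (y + z) = cpow t y * cpow t z.
Proof.
move=> t0; rewrite /cpow ReD ImD mulrACA -rmorphM -powRD; last first.
  by rewrite (gt_eqF t0) implybT.
congr (_ * _); rewrite mulrDl cosD sinD; simpc.
by congr (_ +i* _); ring.
Qed.

Lemma cpowM t x y : 0 < t -> 0 < x -> cpow (t * x) y = cpow t y * cpow x y.
Proof.
move=> t0 x0; rewrite /cpow mulrACA -rmorphM -powRM ?ltW//.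
congr (_ * _); rewrite lnM ?posrE// mulrDr cosD sinD; simpc.
by congr (_ +i* _); ring.
Qed.

Lemma normc_cpow t y : normc (cpow t y) = t `^ complex.Re y.
Proof.
rewrite /cpow normcM normc_real ger0_norm ?powR_ge0//.
by rewrite /normc cos2Dsin2 sqrtr1 mulr1.
Qed.

Lemma cpow0 t : cpow t 0 = 1.
Proof. by rewrite /cpow /= powRr0 mul0r cos0 sin0 mul1r. Qed.

Lemma cpow1 t : 0 < t -> cpow t 1 = t%:C.
Proof.
by move=> t0; rewrite /cpow /= powRr1 ?ltW// mul0r cos0 sin0 mulr1.
Qed.

Lemma cpow_nat t k : 0 < t -> cpow t k%:R = t%:C ^+ k.
Proof.
move=> t0; elim: k => [|k IH]; first by rewrite cpow0 expr0.
by rewrite -natr1 cpowD// IH cpow1// exprSr.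
Qed.

Lemma cpow_neq0 t y : 0 < t -> cpow t y != 0.
Proof. by move=> t0; rewrite -normc_gt0 normc_cpow powR_gt0. Qed.

Lemma cpowN t y : 0 < t -> cpow t (- y) = (cpow t y)^-1.
Proof.
move=> t0; apply: (mulfI (cpow_neq0 y t0)).
by rewrite -cpowD// subrr cpow0 divff// cpow_neq0.
Qed.

Lemma cpowX t n y : 0 < t -> cpow (t ^+ n) y = cpow t y ^+ n.
Proof.
move=> t0; elim: n => [|n IH].
  by rewrite !expr0 /cpow ln1 mulr0 cos0 sin0 powR1 mul1r.
by rewrite !exprS cpowM ?exprn_gt0// IH.
Qed.

Definition is_cderive (f : R -> C) x (d : C) : Prop :=
  is_derive x 1 (fun t => complex.Re (f t)) (complex.Re d) /\
  is_derive x 1 (fun t => complex.Im (f t)) (complex.Im d).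

Lemma is_derive_ext (f g : R -> R) x (df dg : R) :
  is_derive x 1 f df -> f =1 g -> df = dg -> is_derive x 1 g dg.
Proof. by move=> h /funext <- <-. Qed.

Lemma is_cderive_cpow x y : 0 < 1 + x ->
  is_cderive (fun t => cpow (1 + t) y) x (y * cpow (1 + x) (y - 1)).
Proof.
move=> x0; case: y => a b.
have dshift : is_derive x (1 : R) (fun t => 1 + t) 1.
  apply: (is_derive_ext (is_deriveD (is_derive_cst (1 : R) x 1) (is_derive_id x 1))).
    by [].
  by rewrite add0r.
have dpow : is_derive x 1 (fun t : R => (1 + t) `^ a) (a * (1 + x) `^ (a - 1)).
  apply: (is_derive_ext (is_derive1_comp (is_derive1_powR a x0) dshift)) => //.
  by rewrite mulr1.
have dln : is_derive x 1 (fun t : R => b * ln (1 + t)) (b / (1 + x)).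
  apply: (is_derive_ext (is_deriveZ b (is_derive1_comp (is_derive1_ln x0) dshift))) => //.
  by rewrite mulr1.
have dcos := @is_derive1_comp R cos _ x _ _ (is_derive_cos (b * ln (1 + x))) dln.
have dsin := @is_derive1_comp R sin _ x _ _ (is_derive_sin (b * ln (1 + x))) dln.
have pE : (1 + x) `^ a = (1 + x) `^ (a - 1) * (1 + x).
  by rewrite -[X in _ * X]powRr1 ?ltW// -powRD ?subrK// (gt_eqF x0) implybT.
have x1 : 1 + x != 0 by rewrite gt_eqF.
split.
  apply: (is_derive_ext (is_deriveM dpow dcos)) => [t|].
    by rewrite /cpow /= mul0r subr0.
  rewrite /= /GRing.scale/= pE /cpow /= subr0; field.
  exact: x1.
apply: (is_derive_ext (is_deriveM dpow dsin)) => [t|].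
  by rewrite /cpow /= mul0r addr0.
rewrite /= /GRing.scale/= pE /cpow /= subr0; field.
exact: x1.
Qed.

Definition taylor_error (M : nat) y t : C :=
  cpow (1 + t) y - \sum_(0 <= k < M) cbinom y k * t%:C ^+ k.

Lemma is_cderiveB (f g : R -> C) x (d e : C) :
  is_cderive f x d -> is_cderive g x e -> is_cderive (fun t => f t - g t) x (d - e).
Proof.
move=> [f1 f2] [g1 g2]; split.
  by apply: (is_derive_ext (is_deriveB f1 g1)) => [t|]; rewrite ReB.
by apply: (is_derive_ext (is_deriveB f2 g2)) => [t|]; rewrite ImB.
Qed.

Lemma is_cderiveD (f g : R -> C) x (d e : C) :
  is_cderive f x d -> is_cderive g x e -> is_cderive (fun t => f t + g t) x (d + e).
Proof.
move=> [f1 f2] [g1 g2]; split.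
  by apply: (is_derive_ext (is_deriveD f1 g1)) => [t|]; rewrite ReD.
by apply: (is_derive_ext (is_deriveD f2 g2)) => [t|]; rewrite ImD.
Qed.

Lemma is_cderive_ext (f g : R -> C) x (d : C) :
  f =1 g -> is_cderive f x d -> is_cderive g x d.
Proof. by move=> /funext <-. Qed.

Lemma is_cderive_monomial z k x :
  is_cderive (fun t => z * t%:C ^+ k) x (z * (k%:R * x%:C ^+ k.-1)).
Proof.
have dX : is_derive x (1 : R) (fun t : R => t ^+ k) (k%:R * x ^+ k.-1).
  apply: (is_derive_ext (is_deriveX k (is_derive_id x 1))) => [t|].
    by rewrite exprfctE.
  exact: mulr1.
have kE : k%:R * x%:C ^+ k.-1 = (k%:R * x ^+ k.-1)%:C.
  by rewrite rmorphM rmorphXn rmorph_nat.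
rewrite kE; split.
  apply: (is_derive_ext (is_deriveZ (complex.Re z) dX)) => [t|].
    by rewrite -rmorphXn ReM_real.
  by rewrite ReM_real.
apply: (is_derive_ext (is_deriveZ (complex.Im z) dX)) => [t|].
  by rewrite -rmorphXn ImM_real.
by rewrite ImM_real.
Qed.

Lemma cbinom_rec y k : cbinom y k.+1 * k.+1%:R = y * cbinom (y - 1) k.
Proof.
rewrite /cbinom big_ord_recl subr0 factS natrM.
have -> : \prod_(i < k) (y - (bump 0 i)%:R) = \prod_(i < k) (y - 1 - i%:R).
  by apply: eq_bigr => i _; rewrite /bump leq0n add1n -natr1; ring.
field.
by rewrite !pnatr_eq0 -lt0n fact_gt0 addrC natr1 pnatr_eq0.
Qed.

Lemma cbinom0 y : cbinom y 0 = 1.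
Proof. by rewrite /cbinom big_ord0 fact0 divr1. Qed.

Lemma is_cderive_taylor_error M x y : 0 < 1 + x ->
  is_cderive (taylor_error M.+1 y) x (y * taylor_error M (y - 1) x).
Proof.
move=> x0; rewrite /taylor_error mulrBr.
apply: is_cderiveB; first exact: is_cderive_cpow.
elim: M => [|M IH].
  rewrite [X in _ * X]big_geq// mulr0.
  have := is_cderive_monomial (cbinom y 0) 0 x; rewrite mul0r mulr0.
  by apply: is_cderive_ext => t; rewrite big_nat1.
rewrite big_nat_recr//= mulrDr.
have := is_cderiveD IH (is_cderive_monomial (cbinom y M.+1) M.+1 x).
rewrite mulrA cbinom_rec -mulrA.
by apply: is_cderive_ext => t; rewrite [in RHS]big_nat_recr.
Qed.

(** The interval [-1/2, 1] contains both the small relative errors, of any sign,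
and the ratios [x / a n] with [0 <= x < 1]. *)
Lemma mean_value_bound (f : R -> R) (f' : R -> R) (B : R) m x :
    0 <= B -> - 2^-1 <= x <= 1 ->
    (forall t, - 2^-1 <= t <= 1 -> is_derive t 1 f (f' t)) ->
    (forall t, - 2^-1 <= t <= 1 -> `|f' t| <= B * `|t| ^+ m) -> f 0 = 0 ->
  `|f x| <= B * `|x| ^+ m.+1.
Proof.
move=> B0 /andP[x0 x1] df f'b f0.
have cf (a b : R) : - 2^-1 <= a -> b <= 1 -> {within `[a, b], continuous f}.
  move=> a0 b1; apply: derivable_within_continuous => t; rewrite in_itv/= => /andP[at0 tb].
  by apply: ex_derive; apply: df; rewrite (le_trans a0)// (le_trans tb).
have [xn|xp|->] := ltgtP x 0; last by rewrite f0 normr0 mulr_ge0 ?exprn_ge0.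
  have dfx t : t \in `]x, 0[ -> is_derive t 1 f (f' t).
    by rewrite in_itv/= => /andP[t0 t1]; apply: df; apply/andP; split; lra.
  have [c] := MVT xn dfx (cf x 0 x0 ler01).
  rewrite in_itv/= f0 sub0r => /andP[c0 c1] h.
  rewrite -normrN h sub0r normrM normrN exprSr mulrA ler_wpM2r//.
  rewrite (le_trans (f'b c _))//; first by apply/andP; split; lra.
  by rewrite ler_wpM2l// lerXn2r ?nnegrE// !ltr0_norm//; lra.
have dfx t : t \in `]0, x[ -> is_derive t 1 f (f' t).
  by rewrite in_itv/= => /andP[t0 t1]; apply: df; apply/andP; split; lra.
have h0 : - 2^-1 <= (0 : R) by lra.
have [c] := MVT xp dfx (cf 0 x h0 x1).
rewrite in_itv/= f0 !subr0 => /andP[c0 c1] h.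
rewrite h normrM exprSr mulrA ler_wpM2r//.
rewrite (le_trans (f'b c _))//; first by apply/andP; split; lra.
by rewrite ler_wpM2l// lerXn2r ?nnegrE// !gtr0_norm//; lra.
Qed.

Lemma taylor_error0 M y : taylor_error M.+1 y 0 = 0.
Proof.
rewrite /taylor_error addr0 /cpow ln1 mulr0 cos0 sin0 powR1 mul1r.
rewrite big_ltn// cbinom0 expr0 mulr1 [X in _ - (_ + X)](_ : _ = 0) ?addr0 ?subrr//.
by rewrite big_nat big1// => -[|i]// _; rewrite exprS mul0r mulr0.
Qed.

(** The derivative of the error of order [M + 1] is a multiple of the error of
order [M] for the exponent [y - 1]. *)
Lemma taylor_error_bound M y : exists B : R, 0 <= B /\
  forall t, - 2^-1 <= t <= 1 -> normc (taylor_error M y t) <= B * `|t| ^+ M.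
Proof.
elim: M y => [|M IH] y.
  exists (expR (`|complex.Re y| * ln 2)); split; first exact: expR_ge0.
  move=> t /andP[t0 t1]; rewrite /taylor_error big_geq// subr0 normc_cpow.
  have t2 : 0 < 1 + t by lra.
  rewrite expr0 mulr1 /powR gt_eqF// ler_expR (le_trans (ler_norm _))// normrM.
  rewrite ler_wpM2l// ler_norml; apply/andP; split.
    rewrite -lnV ?posrE// ler_ln ?posrE ?invr_gt0//; lra.
  by rewrite ler_ln ?posrE//; lra.
have [B [B0 hB]] := IH (y - 1).
have yB0 : 0 <= normc y * B by rewrite mulr_ge0 ?normc_ge0.
exists (2 * (normc y * B)); split; first by rewrite mulr_ge0.
move=> t t01; rewrite (le_trans (normc_le_ReIm _))//.
have dE x : - 2^-1 <= x <= 1 -> normc (y * taylor_error M (y - 1) x) <= normc y * B * `|x| ^+ M.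
  by move=> /hB h; rewrite normcM -mulrA ler_wpM2l ?normc_ge0.
have pos x : - 2^-1 <= x <= 1 -> 0 < 1 + x by move=> /andP[? _]; lra.
have h1 : `|complex.Re (taylor_error M.+1 y t)| <= normc y * B * `|t| ^+ M.+1.
  apply: (@mean_value_bound (fun t => complex.Re (taylor_error M.+1 y t))
    (fun t => complex.Re (y * taylor_error M (y - 1) t))) => //.
  - by move=> x /pos x0; have [] := is_cderive_taylor_error M y x0.
  - by move=> x /dE; apply: le_trans; exact: Re_le_normc.
  by rewrite taylor_error0.
have h2 : `|complex.Im (taylor_error M.+1 y t)| <= normc y * B * `|t| ^+ M.+1.
  apply: (@mean_value_bound (fun t => complex.Im (taylor_error M.+1 y t))
    (fun t => complex.Im (y * taylor_error M (y - 1) t))) => //.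
  - by move=> x /pos x0; have [] := is_cderive_taylor_error M y x0.
  - by move=> x /dE; apply: le_trans; exact: Im_le_normc.
  by rewrite taylor_error0.
by rewrite -mulrA mulr2n mulrDl mul1r lerD.
Qed.

End ComplexPowers.

(** * The dominant coefficient *)

Section Annihilation.
Variables (F : fieldType) (b : nat -> F).
Implicit Types (p q : {poly F}).

Definition shift_action q n : F := \sum_(i < size q) q`_i * b (n + i)%N.

Lemma shift_action_widen q n N : (size q <= N)%N ->
  shift_action q n = \sum_(i < N) q`_i * b (n + i)%N.
Proof.
move=> qN; rewrite /shift_action (big_ord_widen _ (fun i => q`_i * b (n + i)%N) qN).
rewrite big_mkcond; apply: eq_bigr => i _; case: ltnP => // qi.
by rewrite nth_default// mul0r.
Qed.

Lemma shift_actionD p q n :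
  shift_action (p + q) n = shift_action p n + shift_action q n.
Proof.
rewrite !(@shift_action_widen _ _ (maxn (size p) (size q))) ?leq_maxl ?leq_maxr ?size_polyD//.
by rewrite -big_split/=; apply: eq_bigr => i _; rewrite coefD mulrDl.
Qed.

Lemma shift_actionC c n : shift_action c%:P n = c * b n.
Proof.
rewrite (@shift_action_widen _ _ 1) ?size_polyC_leq1// big_ord1.
by rewrite coefC addn0.
Qed.

Lemma shift_actionZ c q n : shift_action (c *: q) n = c * shift_action q n.
Proof.
rewrite (@shift_action_widen _ _ (size q)) ?size_scale_leq// mulr_sumr.
by apply: eq_bigr => i _; rewrite coefZ mulrA.
Qed.

Lemma shift_actionX q n : shift_action (q * 'X) n = shift_action q n.+1.
Proof.
rewrite (@shift_action_widen _ _ (size q).+1); last first.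
  by rewrite (leq_trans (size_polyMleq _ _))// size_polyX addn2.
rewrite big_ord_recl coefMX eqxx mul0r add0r; apply: eq_bigr => i _.
by rewrite coefMX /= addSnnS.
Qed.

Lemma shift_action_mul p q n :
  shift_action (p * q) n = \sum_(i < size p) p`_i * shift_action q (n + i)%N.
Proof.
have h N : (size p <= N)%N ->
    shift_action (p * q) n = \sum_(i < N) p`_i * shift_action q (n + i)%N.
  elim/poly_ind: p N n => [|p c IH] N n pN.
    rewrite mul0r big1 => [|i _]; last by rewrite coef0 mul0r.
    by rewrite /shift_action size_poly0 big_ord0.
  rewrite mulrDl -mulrA ['X * q]mulrC mulrA shift_actionD shift_actionX.
  rewrite mul_polyC shift_actionZ (IH N); last first.
    have [->|p0] := eqVneq p 0; first by rewrite size_poly0.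
    by move: pN; rewrite size_MXaddC (negPf p0)/=; apply: leq_trans.
  have -> : c * shift_action q n = \sum_(i < N.+1) (c%:P)`_i * shift_action q (n + i)%N.
    rewrite big_ord_recl coefC/= addn0 big1 ?addr0// => i _.
    by rewrite coefC/= mul0r.
  have -> : \sum_(i < N) p`_i * shift_action q (n.+1 + i) =
      \sum_(i < N.+1) (p * 'X)`_i * shift_action q (n + i).
    rewrite big_ord_recl coefMX eqxx mul0r add0r; apply: eq_bigr => i _.
    by rewrite coefMX /= addSnnS.
  rewrite -big_split/= big_ord_recr/= -!mulrDl -coefD nth_default// mul0r addr0.
  by apply: eq_bigr => i _; rewrite -mulrDl -coefD.
by rewrite (h _ (leqnn _)).
Qed.

(** The annihilators of [b] form an ideal, which contains 1 by Bezout. *)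
Lemma irreducible_annihilator p q : irreducible_poly p -> q != 0 ->
    (size q < size p)%N ->
    (forall n, (0 < n)%N -> shift_action p n = 0) ->
    (forall n, (0 < n)%N -> shift_action q n = 0) ->
  forall n, (0 < n)%N -> b n = 0.
Proof.
move=> [p1 pirr] q0 qp pa qa n n0.
have : coprimep p q.
  rewrite /coprimep; apply/negPn/negP => g1.
  have := pirr _ g1 (dvdp_gcdl p q) => gp.
  have : p %| q by rewrite -(eqp_dvdl _ gp) dvdp_gcdr.
  by move/(dvdp_leq q0); rewrite leqNgt qp.
move=> /Bezout_coprimepP[[u v]/=]; rewrite eqp_sym => /eqpP[[c d]/= /andP[c0 d0]] e.
have mulz r w : (forall n, (0 < n)%N -> shift_action r n = 0) ->
    shift_action (w * r) n = 0.
  by move=> ra; rewrite shift_action_mul big1// => i _; rewrite ra ?mulr0// addn_gt0 n0.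
have : shift_action (c *: 1) n = 0.
  by rewrite e shift_actionZ shift_actionD !mulz// addr0 mulr0.
rewrite -[1]/(1%:P) shift_actionZ shift_actionC mul1r => /eqP.
by rewrite mulf_eq0 (negPf c0) => /eqP.
Qed.

(** A singular Hankel matrix yields a recurrence of smaller order, valid at
the first [r] indices, and then at all of them because the recurrence [p]
propagates zeros. *)
Lemma hankel_singular p r : p \is monic -> size p = r.+1 -> irreducible_poly p ->
    (forall n, (0 < n)%N -> shift_action p n = 0) ->
    \det (\matrix_(i < r, j < r) b (i + j).+1) = 0 ->
  forall n, (0 < n)%N -> b n = 0.
Proof.
move=> pm ps pirr pa /eqP/det0P[v v0 vH].
pose q := rVpoly v.
have qr : (size q <= r)%N by exact: size_poly.
have q0 : q != 0.
  by apply: contra_neq v0 => q0; rewrite -[v]rVpolyK -/q q0 linear0.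
apply: (@irreducible_annihilator p q) => //; first by rewrite ps ltnS.
have vq (i : 'I_r) : q`_i = v ord0 i by rewrite coef_rVpoly_ord.
elim/ltn_ind => -[//|n] IH _.
have [nr|rn] := ltnP n r.
  rewrite (shift_action_widen _ qr).
  have := congr1 (fun m : 'rV_r => m ord0 (Ordinal nr)) vH; rewrite !mxE => e.
  rewrite -[RHS]e; apply: eq_bigr => i _; rewrite !mxE vq.
  by rewrite /= addSn addnC.
have nE : n.+1 = ((n - r).+1 + r)%N by rewrite addSn subnK.
have : shift_action (p * q) (n - r).+1 = 0.
  rewrite mulrC shift_action_mul big1// => i _; rewrite pa ?mulr0//.
rewrite shift_action_mul ps big_ord_recr/= -nE big1 ?add0r => [|i _].
  by move: pm; rewrite monicE /lead_coef ps/= => /eqP ->; rewrite mul1r.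
by rewrite IH ?mulr0// nE addSn ltnS ltn_add2l.
Qed.

End Annihilation.

Section DominantRoot.
Variable R : realType.
Local Notation C := R[i].

(** If [lam 1 = 0], the coefficients of the product [W] of the other factors are
in the kernel of the Hankel matrix of [a] over the complex numbers; its
determinant is an integer, so it vanishes over the rationals as well. *)
Lemma dominant_coef_neq0 (a : nat -> int) (P : {poly int}) (r : nat)
    (alpha lam : nat -> C) :
    P \is monic -> annihilates P a ->
    irreducible_poly (map_poly intr P : {poly rat}) -> size P = r.+1 -> (0 < r)%N ->
    map_poly intr P = \prod_(1 <= i < r.+1) ('X - (alpha i)%:P) ->
    (forall n, (1 <= n)%N ->
       (a n)%:~R = \sum_(1 <= i < r.+1) lam i * alpha i ^+ n) ->
    a 1%N != 0 ->
  lam 1%N != 0.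
Proof.
move=> Pm Pa Pirr Pr r0 Proots binet; apply: contra_neq => l0.
pose H := \matrix_(i < r, j < r) a (i + j).+1.
pose W : {poly C} := \prod_(2 <= i < r.+1) ('X - (alpha i)%:P).
have Wr : size W = r.
  by rewrite /W size_prod_XsubC size_iota subSS subn1 prednK.
have detC : \det (map_mx intr H : 'M[C]_r) = 0.
  apply/eqP/det0P; exists (poly_rV W).
    apply/eqP => /(congr1 rVpoly); rewrite poly_rV_K ?Wr// linear0 => W0.
    by move: Wr r0; rewrite W0 size_poly0 => <-.
  apply/rowP => j; rewrite !mxE.
  under eq_bigr => i _.
    rewrite !mxE binet// big_ltn// l0 mul0r add0r mulr_sumr.
    over.
  rewrite exchange_big/= big_nat big1// => k /andP[k2 kr].
  transitivity (lam k * alpha k ^+ j.+1 * W.[alpha k]).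
    rewrite horner_coef Wr mulr_sumr; apply: eq_bigr => i _.
    by rewrite -addnS exprD; ring.
  rewrite /W horner_prod (big_rem k) ?mem_index_iota ?k2//=.
  by rewrite hornerXsubC subrr mul0r mulr0.
have detZ : \det H = 0.
  by apply/eqP; rewrite -(intr_eq0 C) -det_map_mx detC.
pose b n : rat := (a n)%:~R.
have : b 1%N = 0.
  apply: (@hankel_singular _ b (map_poly intr P) r) => //.
  - by rewrite monic_map//; exact: intr_inj.
  - by rewrite size_map_poly_id0 ?Pr// intr_eq0 lead_coef_eq0 monic_neq0.
  - move=> n n0; have := Pa n n0 => /(congr1 (intr : int -> rat)).
    rewrite rmorph_sum rmorph0 => e.
    rewrite (@shift_action_widen _ _ _ _ (size P)) ?size_poly// -[RHS]e.
    by apply: eq_bigr => i _; rewrite coef_map rmorphM.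
  have -> : \matrix_(i, j) b (i + j).+1 = map_mx intr H by apply/matrixP => i j; rewrite !mxE.
  by rewrite det_map_mx detZ.
by move/eqP; rewrite intr_eq0 => /eqP.
Qed.

Lemma uniform_dominance (alpha : nat -> C) (A : R) r : 0 < A ->
    (forall i, (2 <= i <= r)%N -> normc (alpha i) < A) ->
  exists theta : R, [/\ 0 < theta, theta < 1 &
    forall i, (2 <= i <= r)%N -> normc (alpha i) <= theta * A].
Proof.
move=> A0; elim: r => [|r IH] h.
  by exists 2^-1; split=> [||i]; [lra|lra|lia].
have [|th [t0 t1 ht]] := IH; first by move=> i ir; apply: h; lia.
have [r2|r2] := ltnP r 1; first by exists th; split=> // i; lia.
have hr : normc (alpha r.+1) < A by apply: h; lia.
exists (Num.max th (normc (alpha r.+1) / A)); split.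
- by rewrite lt_max t0.
- by rewrite gt_max t1 ltr_pdivrMr// mul1r.
move=> i /andP[i2]; rewrite leq_eqVlt => /orP[/eqP ->|ir].
  by rewrite -ler_pdivrMr// le_max lexx orbT.
by rewrite (le_trans (ht i _)) ?i2// (ler_wpM2r (ltW A0))// le_max lexx.
Qed.

Definition secondary_sum r (alpha lam : nat -> C) n : C :=
  \sum_(2 <= i < r.+1) lam i * alpha i ^+ n.

Lemma secondary_sum_bound r (alpha lam : nat -> C) (B : R) :
    (forall i, (2 <= i <= r)%N -> normc (alpha i) <= B) ->
  forall n, normc (secondary_sum r alpha lam n) <=
    (\sum_(2 <= i < r.+1) normc (lam i)) * B ^+ n.
Proof.
move=> h n; rewrite (le_trans (normc_sum _ _ _))// mulr_suml.
rewrite big_nat [leRHS]big_nat ler_sum// => i ir; rewrite normcM normcX.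
rewrite ler_wpM2l ?normc_ge0// lerXn2r ?nnegrE ?normc_ge0//; last exact: h.
by rewrite (le_trans (normc_ge0 (alpha i)))// h.
Qed.

Lemma geometric_small (E q e : R) : 0 <= q -> q < 1 -> 0 < e ->
  exists n, (0 < n)%N /\ forall m, (n <= m)%N -> E * q ^+ m < e.
Proof.
move=> q0 q1 e0.
have : (fun m => E * q ^+ m) @ \oo --> E * 0.
  by apply: cvgM; [exact: cvg_cst|apply: cvg_expr; rewrite ger0_norm].
rewrite mulr0 => /cvgrPdist_lt/(_ e e0)[N _ hN]; exists N.+1; split=> // m Nm.
have := hN m (ltnW Nm); rewrite sub0r normrN; exact/le_lt_trans/ler_norm.
Qed.

Lemma dominant_coef_gt0 (x : nat -> R) (l : C) (E q : R) : 0 <= q -> q < 1 ->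
    (forall n, (0 < n)%N -> 0 <= x n) -> l != 0 ->
    (forall n, (0 < n)%N -> normc (l - (x n)%:C) <= E * q ^+ n) ->
  exists l1 : R, 0 < l1 /\ l = l1%:C.
Proof.
move=> q0 q1 x0 l0 h.
have Iml : complex.Im l = 0.
  apply/eqP; apply: contraT => Il; have Il0 : 0 < `|complex.Im l| by rewrite normr_gt0.
  have [n [n0 hn]] := geometric_small E q0 q1 Il0.
  have := Im_le_normc (l - (x n)%:C); rewrite ImB/= subr0 leNgt.
  by rewrite (le_lt_trans (h n n0))// hn.
have Rel : 0 <= complex.Re l.
  rewrite leNgt; apply/negP => Rl; have Rl0 : 0 < - complex.Re l by rewrite oppr_gt0.
  have [n [n0 hn]] := geometric_small E q0 q1 Rl0.
  have := Re_le_normc (l - (x n)%:C); rewrite ReB/= leNgt.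
  have := h n n0; have := hn n (leqnn _); have := x0 n n0 => ? ? ?.
  by rewrite ltr0_norm; [|lra]; move/negP; apply; lra.
exists (complex.Re l); have lE : l = (complex.Re l)%:C.
  by rewrite {1}[l]complexE Iml mulr0 addr0.
by split=> //; rewrite lt_def Rel andbT; apply: contra_neq l0 => l0; rewrite lE l0.
Qed.

End DominantRoot.

(** * The nested multinomial expansion *)

Lemma uniq_flatten_fibers (T1 T2 : eqType) (s : seq T1) (f : T1 -> seq T2)
    (h : T2 -> T1) :
    uniq s -> (forall j, uniq (f j)) -> (forall j x, x \in f j -> h x = j) ->
  uniq (flatten [seq f j | j <- s]).
Proof.
move=> + uf hf; elim: s => [//|j s IH] /= /andP[js us].
rewrite cat_uniq uf (IH us) andbT /=; apply/hasPn => x /flatten_mapP[i si xi].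
by apply/negP => /hf hj; move: js; rewrite -hj (hf _ _ xi) si.
Qed.

Section NestedMultinomial.
Variable S : comNzRingType.
Implicit Types (z : nat -> S) (k : seq nat).

(** The sequences indexing the terms of the expansion of a [K]-th power of a sum
of [m] terms. The first term is read with the default value 0, so that the empty
sequence starts with 0 and recurrences of order 1 are not a special case. *)
Fixpoint chains m K : seq (seq nat) :=
  if m is m'.+1 then [seq K :: k | j <- iota 0 K.+1, k <- chains m' j]
  else if K == 0%N then [:: [::]] else [::].

Lemma mem_chains m K k :
  (k \in chains m K) = [&& size k == m, sorted geq k & head 0%N k == K].
Proof.
elim: m K k => [|m IH] K k.
  rewrite /= size_eq0; case: (eqVneq k [::]) => [->|kn]; case: (K).
  - by rewrite inE.
  - by [].
  - by rewrite inE (negPf kn).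
  by [].
apply/allpairsPdep/idP => /= [[j [k' [jK]]]|].
  rewrite IH => /and3P[/eqP sk' sk /eqP hk] ->; rewrite /= sk' !eqxx andbT.
  case: k' hk sk {sk'} => [|a k']//= -> ->; rewrite andbT.
  by move: jK; rewrite -[_ :: _]/(iota 0 K.+1) mem_iota.
case: k => [|a k]//= /and3P[sk pk /eqP <-]; rewrite eqSS in sk.
exists (head 0%N k), k; split=> //.
  rewrite -[_ :: _]/(iota 0 a.+1) mem_iota/= add0n ltnS; case: k pk {sk} => [|b k]//= /andP[].
  by [].
by rewrite IH sk (path_sorted pk) eqxx.
Qed.

Lemma uniq_chains m K : uniq (chains m K).
Proof.
elim: m K => [|m IH] K; first by rewrite /=; case: ifP.
apply: (@uniq_flatten_fibers _ _ (iota 0 K.+1) (fun j => [seq K :: k | k <- chains m j])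
  (fun k => head 0%N (behead k))); first exact: iota_uniq.
  by move=> j; rewrite map_inj_uniq// => ? ? [].
by move=> j k /mapP[k' + ->]; rewrite mem_chains => /and3P[_ _ /eqP].
Qed.

Fixpoint chain_weight z k : S :=
  if k is K :: k' then
    'C(K, head 0%N k')%:R * z 0%N ^+ (K - head 0%N k') *
      chain_weight (fun j => z j.+1) k'
  else 1.

(** The binomial theorem applied to one summand at a time: [k_(i+1)] is the
exponent left to the summands of index larger than [i]. *)
Lemma nested_multinomial m z K :
  (\sum_(0 <= j < m) z j) ^+ K = \sum_(k <- chains m K) chain_weight z k.
Proof.
elim: m z K => [|m IH] z K.
  by rewrite big_geq//= expr0n; case: eqP => _; rewrite ?big_nil ?big_seq1.
rewrite big_nat_recl// exprDn.
rewrite -[chains m.+1 K]/[seq K :: k | j <- iota 0 K.+1, k <- chains m j].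
rewrite big_allpairs_dep -[iota 0 K.+1]/(index_iota 0 K.+1).
rewrite [RHS]big_mkord; apply: eq_bigr => i _; rewrite IH.
rewrite -mulr_natl mulrA mulr_sumr big_seq [RHS]big_seq.
by apply: eq_bigr => k; rewrite mem_chains => /and3P[_ _ /eqP <-].
Qed.

Lemma chain_weightE z k :
  chain_weight z k =
  \prod_(0 <= j < size k) 'C(nth 0%N k j, nth 0%N k j.+1)%:R *
  \prod_(0 <= j < size k) z j ^+ (nth 0%N k j - nth 0%N k j.+1).
Proof.
elim: k z => [|K k IH] z /=; first by rewrite !big_geq// mulr1.
by rewrite IH !big_nat_recl//= nth0 -!mulrA; congr (_ * _); rewrite mulrCA.
Qed.

Lemma chain_weight_kth z (m : nat) k : size k = m ->
  chain_weight (fun j => z j.+2) k =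
  \prod_(1 <= i < m) 'C(kth k i, kth k i.+1)%:R *
  \prod_(2 <= i < m.+2) z i ^+ (kth k i.-1 - kth k i).
Proof.
move=> sk; rewrite chain_weightE sk; congr (_ * _).
  case: m sk => [|m] sk; first by rewrite !big_geq.
  rewrite big_nat_recr//= [nth 0%N k m.+1]nth_default ?sk// bin0 mulr1.
  by rewrite big_add1.
by rewrite (big_addn 0 _ 2) subn2; apply: eq_bigr => i _; rewrite addn2.
Qed.

End NestedMultinomial.

Section ChainTuples.

Definition chain_tuples m M : seq (m.-tuple nat) :=
  pmap insub [seq k | K <- iota 0 M, k <- chains m K].

Lemma val_chain_tuples m M :
  map val (chain_tuples m M) = [seq k | K <- iota 0 M, k <- chains m K].
Proof.
rewrite /chain_tuples pmap_filter; last exact: insubK.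
apply/all_filterP/allP => k /allpairsPdep[K [k' [_ + ->]]].
by rewrite mem_chains => /and3P[sk _ _]; rewrite isSome_insub.
Qed.

Lemma uniq_chain_tuples m M : uniq (chain_tuples m M).
Proof.
rewrite -(map_inj_uniq val_inj) val_chain_tuples.
apply: (@uniq_flatten_fibers _ _ (iota 0 M) (fun K => [seq k | k <- chains m K])
  (fun k => head 0%N k)); first exact: iota_uniq.
  by move=> K; rewrite map_id uniq_chains.
by move=> K k; rewrite map_id mem_chains => /and3P[_ _ /eqP].
Qed.

Lemma mem_chain_tuples m M (k : m.-tuple nat) :
  (k \in chain_tuples m M) = sorted geq k && (kth k 1 < M)%N.
Proof.
rewrite -(mem_map val_inj) val_chain_tuples.
apply/allpairsPdep/andP => [[K [k' [KM + ->]]]|[sk kM]].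
  rewrite mem_chains => /and3P[_ -> /eqP e]; split=> //.
  by rewrite /kth nth0 e; move: KM; rewrite mem_iota.
exists (kth k 1), (val k); split=> //; first by rewrite mem_iota.
by rewrite mem_chains size_tuple eqxx sk /kth nth0 eqxx.
Qed.

Lemma big_chain_tuples (V : nmodType) m M (F : seq nat -> V) :
  \sum_(k <- chain_tuples m M) F k =
  \sum_(0 <= K < M) \sum_(k <- chains m K) F k.
Proof.
by rewrite -(big_map val xpredT F) val_chain_tuples big_allpairs_dep /index_iota subn0.
Qed.

End ChainTuples.

(** * Exponential expansions of powers of the sequence *)

Section ExpansionAlgebra.
Variable R : realType.
Local Notation C := R[i].
Implicit Types (u v : nat -> C) (L : seq (C * C)) (rho sigma : R).

Lemma eventually_geometric (v : nat -> R) (A q : R) N : 0 < q ->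
    (forall n, (N <= n)%N -> v n <= A * q ^+ n) ->
  exists A', forall n, v n <= A' * q ^+ n.
Proof.
move=> q0 h; exists (`|A| + \sum_(0 <= i < N) `|v i| / q ^+ i) => n.
have qn m : 0 < q ^+ m by exact: exprn_gt0.
have pos : 0 <= \sum_(0 <= i < N) `|v i| / q ^+ i.
  by apply: sumr_ge0 => i _; rewrite divr_ge0// ltW.
have [Nn|nN] := leqP N n.
  rewrite (le_trans (h n Nn))// (ler_wpM2r (ltW (qn n)))//.
  by rewrite (le_trans (ler_norm _))// lerDl.
rewrite -ler_pdivrMr// -[leLHS]add0r lerD//.
rewrite (bigD1_seq n) ?mem_index_iota ?iota_uniq//= -[leLHS]addr0 lerD//.
  by rewrite ler_pM2r ?invr_gt0// ler_norm.
by apply: sumr_ge0 => i _; rewrite divr_ge0// ltW.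
Qed.

Lemma le_geometric (A q q' : R) n : 0 <= q -> q <= q' ->
  A * q ^+ n <= `|A| * q' ^+ n.
Proof.
move=> q0 qq; rewrite (le_trans (ler_norm _))// normrM.
rewrite ler_wpM2l// ger0_norm ?exprn_ge0// lerXn2r ?nnegrE//.
exact: le_trans qq.
Qed.

Lemma expansion_remainder_only v rho sigma (A q : R) : 0 < q -> q * sigma < 1 ->
  (forall n, (1 <= n)%N -> normc (v n) <= A * q ^+ n) -> expansion v rho sigma [::].
Proof.
move=> q0 qs h; exists A, q; split=> // n n1.
by rewrite big_nil subr0 h.
Qed.

Lemma expansion_ext u v rho sigma L : (forall n, (1 <= n)%N -> u n = v n) ->
  expansion u rho sigma L -> expansion v rho sigma L.
Proof.
move=> uv [A [q [q0 qs h hL]]]; exists A, q; split=> // n n1.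
by rewrite -uv// h.
Qed.

Lemma expansion_scale u rho sigma L b : expansion u rho sigma L ->
  expansion (fun n => b * u n) rho sigma [seq (b * p.1, p.2) | p <- L].
Proof.
move=> [A [q [q0 qs h hL]]]; exists (normc b * A), q; split=> //.
  move=> n n1; rewrite big_map.
  under eq_bigr do rewrite /= -mulrA.
  by rewrite -mulr_sumr -mulrBr normcM -mulrA ler_wpM2l ?normc_ge0// h.
by move=> p /mapP[p' /hL + ->].
Qed.

Lemma expansion_add u v rho sigma L1 L2 :
    expansion u rho sigma L1 -> expansion v rho sigma L2 ->
  expansion (fun n => u n + v n) rho sigma (L1 ++ L2).
Proof.
move=> [A1 [q1 [q10 qs1 h1 hL1]]] [A2 [q2 [q20 qs2 h2 hL2]]].
exists (`|A1| + `|A2|), (Num.max q1 q2); split.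
- by rewrite lt_max q10.
- by rewrite /Num.max; case: ifP.
- move=> n n1; rewrite big_cat/= opprD addrACA.
  rewrite (le_trans (le_normcD _ _))// mulrDl lerD//.
    rewrite (le_trans (h1 n n1))// le_geometric ?(ltW q10)//.
    by rewrite le_max lexx.
  rewrite (le_trans (h2 n n1))// le_geometric ?(ltW q20)//.
  by rewrite le_max lexx orbT.
by move=> p; rewrite mem_cat => /orP[/hL1|/hL2].
Qed.

Lemma expansion_le_rho u rho rho' sigma L : rho' <= rho ->
  expansion u rho sigma L -> expansion u rho' sigma L.
Proof.
move=> rr [A [q [q0 qs h hL]]]; exists A, q; split=> // p /hL; apply: le_trans.
by rewrite ler_wpM2l ?normc_ge0.
Qed.

Lemma residue_coef_cat L1 L2 z0 :
  residue_coef (L1 ++ L2) z0 = residue_coef L1 z0 + residue_coef L2 z0.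
Proof. by rewrite /residue_coef big_cat mulrDr. Qed.

Lemma residue_coef_scale L b z0 :
  residue_coef [seq (b * p.1, p.2) | p <- L] z0 = b * residue_coef L z0.
Proof. by rewrite /residue_coef big_map/= -mulr_sumr mulrCA. Qed.

Lemma expansion_linear_combination (J : nat) (u : nat -> nat -> C) (b : nat -> C)
    (L : nat -> seq (C * C)) rho sigma z0 : 0 < sigma ->
    (forall j, expansion (u j) rho sigma (L j)) ->
  exists L', expansion (fun n => \sum_(0 <= j < J) b j * u j n) rho sigma L' /\
    residue_coef L' z0 = \sum_(0 <= j < J) b j * residue_coef (L j) z0.
Proof.
move=> s0 h; elim: J => [|J [L' [h' e']]].
  exists [::]; split; last by rewrite /residue_coef big_nil mulr0 big_geq.
  apply: (@expansion_remainder_only _ _ _ 0 (sigma^-1 / 2)).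
  - by rewrite divr_gt0// invr_gt0.
  - by rewrite mulrAC mulVf ?gt_eqF// mul1r invf_lt1// ltr1n.
  by move=> n _; rewrite big_geq// normc0 mul0r.
exists (L' ++ [seq (b J * p.1, p.2) | p <- L J]); split.
  apply: expansion_ext (expansion_add h' (expansion_scale (b J) (h J))) => n _.
  by rewrite big_nat_recr.
by rewrite residue_coef_cat residue_coef_scale e' big_nat_recr.
Qed.

End ExpansionAlgebra.

Section ChainExponents.
Variable R : realType.
Local Notation C := R[i].
Variables (r : nat) (alpha lam : nat -> C) (A : R).
Hypothesis A0 : 0 < A.

(** The reciprocal of the product that defines [tau]. *)
Definition chain_exponent (s : C) (k : r.-1.-tuple nat) : C :=
  cpow A (- s - (kth k 1)%:R) *
  \prod_(2 <= i < r.+1) alpha i ^+ (kth k i.-1 - kth k i).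

(** Telescoping, with the value 0 past the end. *)
Lemma sum_chain_drops (k : seq nat) : sorted geq k ->
  (\sum_(0 <= j < size k) (nth 0 k j - nth 0 k j.+1) = head 0 k)%N.
Proof.
elim: k => [|K k IH]; first by rewrite big_geq.
move=> pk; rewrite big_nat_recl//= IH ?(path_sorted pk)// nth0 subnK//.
by case: k pk {IH} => [|b k]//= /andP[].
Qed.

(** The exponents of the [alpha i] add up to [k_1], which gives one factor
[theta] for each factor [A ^- 1] of [cpow A (- s - k_1)]. *)
Lemma chain_exponent_bound (theta : R) s (k : r.-1.-tuple nat) : 0 < theta -> (0 < r)%N ->
    (forall i, (2 <= i <= r)%N -> normc (alpha i) <= theta * A) -> sorted geq k ->
  normc (chain_exponent s k) <= A `^ (- complex.Re s) * theta ^+ kth k 1.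
Proof.
move=> t0 r0 ha sk; rewrite /chain_exponent cpowD// (cpowN (kth k 1)%:R)// cpow_nat//.
rewrite normcM normcM normc_cpow normcV normcX normc_real gtr0_norm//.
rewrite (_ : complex.Re (- s) = - complex.Re s); last by case: (s).
rewrite -mulrA ler_wpM2l ?powR_ge0// mulrC ler_pdivrMr ?exprn_gt0// -exprMn.
have -> : kth k 1 = (\sum_(2 <= i < r.+1) (kth k i.-1 - kth k i))%N.
  have e := sum_chain_drops sk; rewrite size_tuple in e.
  rewrite {1}/kth nth0 -e (big_addn 0 _ 2) subSS subn1.
  by apply: eq_bigr => i _; rewrite addn2.
rewrite expr_sum.
rewrite (big_morph _ (@normcM R) (@normc1 R)) big_nat [leRHS]big_nat.
apply: ler_prod => i ir; rewrite normcX exprn_ge0 ?normc_ge0//=.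
rewrite lerXn2r ?nnegrE ?normc_ge0//; first by rewrite mulr_ge0// ltW.
exact: ha.
Qed.

End ChainExponents.

Lemma powR_expr (R : realType) (x p : R) n : 0 <= x -> (x ^+ n) `^ p = (x `^ p) ^+ n.
Proof.
by move=> x0; rewrite -powR_mulrn// -powRrM mulrC powRrM powR_mulrn ?powR_ge0.
Qed.

Section DominatedSequence.
Variable R : realType.
Local Notation C := R[i].
Variables (a : nat -> R) (r : nat) (alpha lam : nat -> C) (A l1 theta : R).
Hypotheses (A1 : 1 < A) (l10 : 0 < l1) (r0 : (0 < r)%N).
Hypotheses (theta0 : 0 < theta) (theta1 : theta < 1).
Hypothesis lam1E : lam 1%N = l1%:C.
Hypothesis alpha_bound : forall i, (2 <= i <= r)%N -> normc (alpha i) <= theta * A.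
Hypothesis a_gt0 : forall n, (1 <= n)%N -> 0 < a n.
Hypothesis aE : forall n, (1 <= n)%N ->
  (a n)%:C = l1%:C * A%:C ^+ n + secondary_sum r alpha lam n.

Let A0 : 0 < A. Proof. exact: lt_trans A1. Qed.
Let lA0 n : 0 < l1 * A ^+ n. Proof. by rewrite mulr_gt0// exprn_gt0. Qed.

Definition relative_error n : R := a n / (l1 * A ^+ n) - 1.

Lemma relative_errorE n : a n = l1 * A ^+ n * (1 + relative_error n).
Proof. by rewrite /relative_error addrC subrK mulrC divfK// gt_eqF. Qed.

Lemma relative_error_sum n : (1 <= n)%N ->
  (relative_error n)%:C * (l1%:C * A%:C ^+ n) = secondary_sum r alpha lam n.
Proof.
move=> n1; have := aE n1; rewrite {1}relative_errorE -rmorphXn -rmorphM.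
rewrite mulrDr mulr1 rmorphD /= => /addrI <-.
by rewrite -rmorphM mulrC.
Qed.

Lemma relative_error_bound : exists T : R, 0 <= T /\
  forall n, (1 <= n)%N -> `|relative_error n| <= T * theta ^+ n.
Proof.
exists ((\sum_(2 <= i < r.+1) normc (lam i)) / l1); split.
  by rewrite divr_ge0 ?(ltW l10)// sumr_ge0// => i _; exact: normc_ge0.
move=> n n1; have h := secondary_sum_bound lam alpha_bound n.
rewrite -relative_error_sum// normcM normc_real -rmorphXn -rmorphM normc_real in h.
rewrite (gtr0_norm (lA0 n)) exprMn in h.
rewrite mulrAC ler_pdivlMr// -(ler_pM2r (exprn_gt0 n A0)).
by move: h; rewrite !mulrA.
Qed.

Lemma relative_error_small : exists N, forall n, (N <= n)%N ->
  - 2^-1 <= relative_error n <= 2^-1.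
Proof.
have [T [T0 hT]] := relative_error_bound.
have h2 : 0 < (2^-1 : R) by lra.
have [N [N0 hN]] := geometric_small T (ltW theta0) theta1 h2.
exists N => n Nn; rewrite -ler_norml (le_trans (hT n _))//; first exact: leq_trans Nn.
exact/ltW/hN.
Qed.

Lemma power_bound (p : R) : exists B : R,
  forall n, (1 <= n)%N -> a n `^ p <= B * (A `^ p) ^+ n.
Proof.
have [N hN] := relative_error_small.
have [B [B0 hB]] := taylor_error_bound 0 (p%:C).
have Ap : 0 < A `^ p by exact: powR_gt0.
suff [B' hB'] : exists B', forall n, a n `^ p <= B' * (A `^ p) ^+ n.
  by exists B' => n _.
apply: (@eventually_geometric _ _ (l1 `^ p * B) _ N) => // n Nn.
have /andP[t1 t2] := hN n Nn.
have t3 : 0 <= 1 + relative_error n by lra.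
rewrite relative_errorE powRM ?(ltW (lA0 n))//.
rewrite powRM ?(ltW l10)// ?exprn_ge0 ?(ltW A0)// powR_expr ?(ltW A0)//.
rewrite [leRHS]mulrAC ler_wpM2l//.
  by rewrite mulr_ge0 ?powR_ge0// exprn_ge0// powR_ge0.
have := hB (relative_error n); rewrite /taylor_error big_geq// subr0 normc_cpow.
by rewrite expr0 mulr1; apply; apply/andP; split; lra.
Qed.

(** The [K]-th power of [relative_error n] is expanded by [nested_multinomial];
its terms are those of the chains starting with [K]. *)
Lemma binomial_chain_sum s M n : (1 <= n)%N ->
  \sum_(k <- chain_tuples r.-1 M) Lambda lam s k * chain_exponent alpha A s k ^+ n =
  cpow l1 (- s) * cpow A (- s) ^+ n *
    \sum_(0 <= K < M) cbinom (- s) K * (relative_error n)%:C ^+ K.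
Proof.
move=> n1; case: r r0 lam alpha lam1E (relative_error_sum n1) => [//|m] _ la al la1 te /=.
pose z i := la i * al i ^+ n.
pose F k := cbinom (- s) (kth k 1) * cpow l1 (- s - (kth k 1)%:R) *
  cpow A (- s - (kth k 1)%:R) ^+ n * chain_weight (fun j => z j.+2) k.
rewrite (eq_bigr (fun k => F (val k))) => [|k _]; last first.
  rewrite /F (@chain_weight_kth _ _ m) ?size_tuple// /Lambda /chain_exponent la1 /=.
  have -> : \prod_(2 <= i < m.+2) z i ^+ (kth (val k) i.-1 - kth (val k) i) =
      \prod_(2 <= i < m.+2) la i ^+ (kth (val k) i.-1 - kth (val k) i) *
      (\prod_(2 <= i < m.+2) al i ^+ (kth (val k) i.-1 - kth (val k) i)) ^+ n.
    rewrite -prodrXl -big_split; apply: eq_bigr => i _ /=.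
    by rewrite /z exprMn exprAC.
  rewrite exprMn.
  move: (cbinom _ _) (cpow l1 _) (cpow A _ ^+ n) => b1 b2 b3.
  by rewrite -!mulrA; congr (_ * _); rewrite mulrCA; congr (_ * _); ring.
rewrite (big_chain_tuples _ _ F) mulr_sumr; apply: eq_bigr => K _.
transitivity (cbinom (- s) K * cpow l1 (- s - K%:R) * cpow A (- s - K%:R) ^+ n *
    (\sum_(0 <= j < m) z j.+2) ^+ K).
  rewrite (nested_multinomial m (fun j => z j.+2)) mulr_sumr big_seq [RHS]big_seq.
  apply: eq_bigr => k; rewrite mem_chains => /and3P[_ _ /eqP kK].
  by rewrite /F /kth nth0 kK.
have -> : \sum_(0 <= j < m) z j.+2 = secondary_sum m.+1 al la n.
  rewrite /secondary_sum (big_addn 0 _ 2) subn2.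
  by apply: eq_bigr => j _; rewrite addn2.
rewrite -te !cpowD// !(cpowN K%:R)// !cpow_nat// !exprMn exprVn.
rewrite [(A%:C ^+ n) ^+ K]exprAC.
have x0 : l1%:C ^+ K != 0 by rewrite expf_neq0// eq_complex /= gt_eqF.
have y0 : A%:C ^+ K ^+ n != 0 by rewrite !expf_neq0// eq_complex /= gt_eqF.
move: (l1%:C ^+ K) (A%:C ^+ K ^+ n) x0 y0 => x y x0 y0.
move: (cbinom _ _) (cpow _ _) (_ ^+ n) (_ ^+ K) => b1 b2 b3 b4.
by field; rewrite x0 y0.
Qed.

(** After division by its dominant term the sequence tends to 1, and the error
term of the binomial series of order [M] is [O (theta ^ (n M))]. *)
Lemma expansion_at_0 s sigma M : A `^ (- complex.Re s) * theta ^+ M * sigma < 1 ->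
  expansion (fun n => cpow (a n + 0) (- s)) (A `^ complex.Re s) sigma
    [seq (Lambda lam s k, chain_exponent alpha A s k) | k <- chain_tuples r.-1 M].
Proof.
move=> qs; set q := A `^ (- complex.Re s) * theta ^+ M in qs.
have q0 : 0 < q by rewrite mulr_gt0 ?powR_gt0// exprn_gt0.
have ReN : complex.Re (- s) = - complex.Re s by case: (s).
have [N hN] := relative_error_small.
have [B [B0 hB]] := taylor_error_bound M (- s).
have [T [T0 hT]] := relative_error_bound.
pose v n := normc (cpow (a n + 0) (- s) -
  \sum_(k <- chain_tuples r.-1 M) Lambda lam s k * chain_exponent alpha A s k ^+ n).
suff [A' hA'] : exists A', forall n, v n <= A' * q ^+ n.
  exists A', q; split=> //; first by move=> n _; rewrite big_map; exact: hA'.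
  move=> p /mapP[k]; rewrite mem_chain_tuples => /andP[sk _] -> /=.
  rewrite (le_trans (ler_wpM2r (powR_ge0 _ _)
    (chain_exponent_bound A0 s theta0 r0 alpha_bound sk)))//.
  rewrite mulrAC powRN mulVf ?gt_eqF ?powR_gt0// mul1r.
  by rewrite exprn_ile1 ?(ltW theta0)// ltW.
apply: (@eventually_geometric _ _ (l1 `^ (- complex.Re s) * (B * T ^+ M)) _ N.+1) => // n Nn.
have /andP[t1 t2] := hN n (ltnW Nn).
have n1 : (1 <= n)%N by exact: leq_ltn_trans Nn.
have t3 : 0 < 1 + relative_error n by lra.
rewrite /v binomial_chain_sum// addr0 {1}relative_errorE.
rewrite !cpowM ?exprn_gt0// cpowX// -mulrBr.
rewrite [normc (cpow l1 _ * _ * _)]normcM [normc (cpow l1 _ * _)]normcM.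
rewrite normcX !normc_cpow ReN.
rewrite -[leRHS]mulrA -[leLHS]mulrA ler_wpM2l ?powR_ge0//.
rewrite /q exprMn [leRHS]mulrCA ler_wpM2l ?exprn_ge0 ?powR_ge0//.
have := hB (relative_error n); rewrite /taylor_error => h.
rewrite (le_trans (h _))//; first by apply/andP; split; lra.
rewrite -mulrA ler_wpM2l// exprAC -exprMn lerXn2r ?nnegrE//.
  by rewrite mulr_ge0// exprn_ge0// ltW.
exact: hT.
Qed.

Lemma power_decay (p sigma : R) : 0 < sigma -> exists J0, forall J, (J0 <= J)%N ->
  A `^ (- (p + J%:R)) * sigma < 1.
Proof.
move=> s0; have iA : A^-1 < 1 by rewrite invf_lt1.
have iA0 : 0 <= A^-1 by rewrite invr_ge0 ltW.
have [J0 [_ h]] := geometric_small (A `^ (- p) * sigma) iA0 iA ltr01.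
exists J0 => J /h; apply: le_lt_trans; rewrite opprD powRD; last first.
  by rewrite (gt_eqF A0) implybT.
by rewrite (powRN A J%:R) powR_mulrn ?(ltW A0)// exprVn mulrAC.
Qed.

Lemma truncation_order s sigma : 0 < sigma -> exists M0, forall M, (M0 <= M)%N ->
  A `^ (- complex.Re s) * theta ^+ M * sigma < 1.
Proof.
move=> s0.
have [M0 [_ h]] := geometric_small (A `^ (- complex.Re s) * sigma) (ltW theta0) theta1 ltr01.
by exists M0 => M /h; rewrite mulrAC.
Qed.

(** Here the binomial series is taken in [x / a n], and its terms are the
sequences for the exponents [s + j] at [x = 0]. *)
Lemma expansion_at_x s sigma (J : nat) (L : nat -> seq (C * C)) z0 x :
    0 < sigma -> 0 <= x -> x < 1 -> (forall n, (1 <= n)%N -> 1 <= a n) ->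
    A `^ (- (complex.Re s + J%:R)) * sigma < 1 ->
    (forall j, expansion (fun n => cpow (a n + 0) (- (s + j%:R)))
       (A `^ complex.Re (s + j%:R)) sigma (L j)) ->
  exists L', expansion (fun n => cpow (a n + x) (- s)) (A `^ complex.Re s) sigma L' /\
    residue_coef L' z0 =
    \sum_(0 <= j < J) cbinom (- s) j * residue_coef (L j) z0 * x%:C ^+ j.
Proof.
move=> s0 x0 x1 a1 Js hL.
have ReN : complex.Re (- s) = - complex.Re s by case: (s).
have hL' j : expansion (fun n => cpow (a n + 0) (- (s + j%:R)))
    (A `^ complex.Re s) sigma (L j).
  apply: expansion_le_rho (hL j); rewrite ReD ler_powR ?(ltW A1)//.
  rewrite lerDl; have -> : complex.Re (j%:R : C) = j%:R.
    by rewrite -(rmorph_nat (real_complex R)).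
  exact: ler0n.
have [L' [h e]] := expansion_linear_combination J (fun j => cbinom (- s) j * x%:C ^+ j) z0 s0 hL'.
have [B [B0 hB]] := taylor_error_bound J (- s).
have [D hD] := power_bound (- (complex.Re s + J%:R)).
pose v n := cpow (a n) (- s) * taylor_error J (- s) (x / a n).
have hv : expansion v (A `^ complex.Re s) sigma [::].
  apply: (@expansion_remainder_only _ _ _ _ (B * D) (A `^ (- (complex.Re s + J%:R)))) => //.
    exact: powR_gt0.
  move=> n n1; have an := a_gt0 n1; rewrite /v normcM normc_cpow ReN.
  have xa0 : 0 <= x / a n by rewrite divr_ge0// ltW.
  have xa1 : x / a n <= 1 by rewrite ler_pdivrMr// mul1r (le_trans (ltW x1))// a1.
  have hb : normc (taylor_error J (- s) (x / a n)) <= B * a n `^ (- J%:R).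
    rewrite (le_trans (hB _ _))//; first by apply/andP; split; lra.
    rewrite ler_wpM2l// ger0_norm// powRN powR_mulrn ?(ltW an)// -exprVn.
    rewrite lerXn2r ?nnegrE ?invr_ge0 ?(ltW an)//.
    by rewrite -[leRHS]mul1r ler_wpM2r ?invr_ge0 ?(ltW an)// ltW.
  rewrite (le_trans (ler_wpM2l (powR_ge0 _ _) hb))// mulrCA -mulrA ler_wpM2l//.
  rewrite -powRD; last by rewrite (gt_eqF an) implybT.
  by rewrite -opprD hD.
exists (L' ++ [::]); split; last first.
  by rewrite cats0 e; apply: eq_bigr => j _; rewrite mulrAC.
apply: expansion_ext (expansion_add h hv) => n n1; have an := a_gt0 n1.
have xa : 0 < 1 + x / a n by rewrite ltr_wpDr// divr_ge0// ltW.
have -> : a n + x = a n * (1 + x / a n) by rewrite mulrDr mulr1 mulrC divfK// gt_eqF.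
rewrite cpowM// /v /taylor_error mulrBr addrC mulr_sumr.
rewrite -addrA [X in _ + X](_ : _ = 0) ?addr0//.
apply/eqP; rewrite addrC subr_eq0; apply/eqP; apply: eq_bigr => j _.
rewrite opprD cpowD// (cpowN j%:R)// cpow_nat// rmorphM exprMn.
rewrite fmorphV exprVn; ring.
Qed.

End DominatedSequence.

(** * Residues of the continued series *)

Lemma chain_exponent_tau (R : realType) (r : nat) (alpha : nat -> R[i]) (A : R)
    (s z0 : R[i]) (k : r.-1.-tuple nat) : (0 < r)%N -> 0 < A ->
    alpha 1%N = A%:C -> sorted geq k ->
  (z0 = cpow (complex.Re (alpha 1%N)) (s + (kth k 1)%:R) *
      \prod_(2 <= i < r.+1) alpha i ^ ((kth k i)%:Z - (kth k i.-1)%:Z)) <->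
  z0 = (chain_exponent alpha A s k)^-1.
Proof.
move=> r0 A0 -> sk /=; suff -> : (chain_exponent alpha A s k)^-1 =
   cpow A (s + (kth k 1)%:R) *
   \prod_(2 <= i < r.+1) alpha i ^ ((kth k i)%:Z - (kth k i.-1)%:Z) by [].
rewrite /chain_exponent invfM -cpowN// opprD !opprK -prodfV; congr (_ * _).
rewrite big_nat [RHS]big_nat; apply: eq_bigr => i /andP[i2 ir].
have ki : (kth k i <= kth k i.-1)%N.
  rewrite /kth; case: i i2 ir => [|[|i]]//= _ ir.
  have [ik|ki] := ltnP i.+1 (size k); last by rewrite [nth _ _ i.+1]nth_default.
  have geq_trans : transitive geq by move=> m n p nm mp; exact: leq_trans mp nm.
  by have := sorted_ltn_nth geq_trans 0%N sk i i.+1; rewrite !inE ik (ltnW ik); apply.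
by rewrite -opprB subzn// -invr_expz -exprnP.
Qed.

Theorem proposition6p3 (R : realType) (a : nat -> int) (P : {poly int})
    (r : nat) (alpha lam : nat -> R[i])
    (P_min : is_minimal_polynomial P a)
    (P_irr : irreducible_poly (map_poly intr P : {poly rat}))
    (P_deg : size P = r.+1)
    (P_roots : map_poly intr P = \prod_(1 <= i < r.+1) ('X - (alpha i)%:P))
    (alpha1_gt1 : 1 < alpha 1%N)
    (alpha1_dom : forall i, (2 <= i <= r)%N -> `|alpha i| < alpha 1%N)
    (lam_field : forall i, (1 <= i <= r)%N -> in_Q_adjoin (alpha i) (lam i))
    (binet : forall n, (1 <= n)%N ->
       (a n)%:~R = \sum_(1 <= i < r.+1) lam i * alpha i ^+ n)
    (a_gt0 : forall n, (1 <= n)%N -> 0 < a n)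
    (a_incr : forall n, (1 <= n)%N -> a n < a n.+1) :
  (forall (s z0 : R[i]), exists j0 : nat, forall x : R, 0 <= x < 1 ->
     pole (phi a (alpha 1%N) s x) z0 ->
     residue (phi a (alpha 1%N) s x) z0 =
     \sum_(0 <= j < j0.+1) cbinom (- s) j *
       residue (phi a (alpha 1%N) (s + j%:R) 0) z0 * x%:C ^+ j) /\
  (forall (s z0 : R[i]), pole (phi a (alpha 1%N) s 0) z0 ->
     finite_set (tau r alpha s z0) /\
     residue (phi a (alpha 1%N) s 0) z0 =
     - z0 * \sum_(k \in tau r alpha s z0) Lambda lam s k).
Proof.
have r0 : (0 < r)%N.
  have [+ _] := P_irr; have [Pm _ _] := P_min.
  by rewrite size_map_poly_id0 ?P_deg// intr_eq0 lead_coef_eq0 monic_neq0.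
pose A := complex.Re (alpha 1%N).
have [A1 alE] : 1 < A /\ alpha 1%N = A%:C.
  move: alpha1_gt1; rewrite ltcE /= => /andP[/eqP h1 h2]; split; first exact: h2.
  by rewrite {1}[alpha 1%N]complexE h1 mulr0 addr0.
have A0 : 0 < A by exact: lt_trans A1.
have [th [th0 th1 hth]] : exists theta : R, [/\ 0 < theta, theta < 1 &
    forall i, (2 <= i <= r)%N -> normc (alpha i) <= theta * A].
  apply: uniform_dominance => // i /alpha1_dom.
  by rewrite alE norm_normc ltcR.
pose b n : R := (a n)%:~R.
have b0 n : (1 <= n)%N -> 0 < b n by move=> /a_gt0; rewrite ltr0z.
have b1 n : (1 <= n)%N -> 1 <= b n.
  by move=> /a_gt0; rewrite ler1z.
have bE n : (1 <= n)%N -> (b n)%:C = lam 1%N * A%:C ^+ n + secondary_sum r alpha lam n.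
  by move=> n1; rewrite rmorph_int binet// big_ltn// alE.
have [l1 [l10 lamE]] : exists l1 : R, 0 < l1 /\ lam 1%N = l1%:C.
  pose E := \sum_(2 <= i < r.+1) normc (lam i).
  apply: (@dominant_coef_gt0 _ (fun n => b n / A ^+ n) _ E th) => //.
  - exact: ltW.
  - by move=> n n1; rewrite divr_ge0 ?exprn_ge0 ?(ltW A0)// ltW// b0.
  - have [Pm Pa _] := P_min.
    apply: (dominant_coef_neq0 Pm Pa P_irr P_deg r0 P_roots binet).
    by rewrite gt_eqF// a_gt0.
  move=> n n1; rewrite rmorphM fmorphV rmorphXn/= bE// mulrDl mulfK; last first.
    by rewrite expf_neq0// eq_complex /= gt_eqF.
  rewrite opprD addrA subrr add0r normcN normcM normcV -rmorphXn normc_real.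
  rewrite gtr0_norm ?exprn_gt0// ler_pdivrMr ?exprn_gt0// -mulrA -exprMn.
  exact: secondary_sum_bound.
have rho0 s : 0 < A `^ complex.Re s by exact: powR_gt0.
have bE' n : (1 <= n)%N -> (b n)%:C = l1%:C * A%:C ^+ n + secondary_sum r alpha lam n.
  by rewrite -lamE; exact: bE.
have exp0 := expansion_at_0 A1 l10 r0 th0 th1 lamE hth bE'.
pose L0 s M := [seq (Lambda lam s k, chain_exponent alpha A s k) | k <- chain_tuples r.-1 M].
have ex0 s sigma : 0 < sigma ->
    exists L, expansion (fun n => cpow (b n + 0) (- s)) (A `^ complex.Re s) sigma L.
  move=> s0; have [M0 hM] := truncation_order A th0 th1 s s0.
  by exists (L0 s M0); apply: exp0; exact: hM.
have exx x s sigma : 0 <= x -> x < 1 -> 0 < sigma ->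
    exists L, expansion (fun n => cpow (b n + x) (- s)) (A `^ complex.Re s) sigma L.
  move=> x0 x1 s0; have [J0 hJ] := power_decay A1 (complex.Re s) s0.
  have /choice[L hL] j := ex0 (s + j%:R) sigma s0.
  have [L' [h _]] := expansion_at_x A1 l10 th0 th1 hth b0 bE' 0 s0 x0 x1 b1 (hJ _ (leqnn _)) hL.
  by exists L'.
split=> [s z0|s z0 zp].
  have s0 : 0 < normc z0 + 1 by rewrite ltr_wpDl ?normc_ge0.
  have zs : normc z0 < normc z0 + 1 by rewrite ltrDl.
  have [J0 hJ] := power_decay A1 (complex.Re s) s0.
  have /choice[L hL] j := ex0 (s + j%:R) (normc z0 + 1) s0.
  exists J0 => x /andP[x0 x1] _.
  have [L' [h e]] := expansion_at_x A1 l10 th0 th1 hth b0 bE' z0 s0 x0 x1 b1 (hJ _ (leqnSn _)) hL.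
  rewrite /phi (continuation_residue (rho0 s) (fun sg => exx x s sg x0 x1) h zs) e.
  apply: eq_bigr => j _; congr (_ * _ * _).
  by rewrite (continuation_residue (rho0 _) (ex0 (s + j%:R)) (hL j) zs).
have s0 : 0 < normc z0 + 1 by rewrite ltr_wpDl ?normc_ge0.
have zs : normc z0 < normc z0 + 1 by rewrite ltrDl.
have z00 : z0 != 0 := continuation_pole (rho0 s) (ex0 s) zp.
have [M hM] := truncation_order A th0 th1 s s0.
have hexp := exp0 s (normc z0 + 1) M (hM _ (leqnn _)).
have tauE : tau r alpha s z0 =
    [set` [seq k <- chain_tuples r.-1 M | chain_exponent alpha A s k * z0 == 1]].
  apply/seteqP; split=> k /=; rewrite mem_filter mem_chain_tuples.
    move=> [sk] /(chain_exponent_tau _ _ r0 A0 alE sk) zE.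
    have ez : chain_exponent alpha A s k * z0 = 1.
      rewrite zE divff//; apply: contraNneq z00 => e0.
      by rewrite zE e0 invr0.
    (* the bound on [chain_exponent] excludes [M <= k_1] *)
    rewrite ez eqxx sk /= ltnNge; apply/negP => Mk.
    have := chain_exponent_bound A0 s th0 r0 hth sk.
    have nz : 0 < normc z0 by rewrite normc_gt0.
    rewrite -(ler_pM2r nz) -normcM ez normc1 leNgt => /negP; apply.
    apply: le_lt_trans (hM _ Mk); rewrite ler_wpM2l ?(ltW zs)//.
    by rewrite mulr_ge0 ?powR_ge0// exprn_ge0// ltW.
  move=> /andP[/eqP ez /andP[sk _]]; split; first exact: sk.
  apply/(chain_exponent_tau _ _ r0 A0 alE sk).
  have c0 : chain_exponent alpha A s k != 0.
    by apply: contra_eq_neq ez => ->; rewrite mul0r eq_sym oner_eq0.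
  by apply: (mulfI c0); rewrite ez divff.
split; first by rewrite tauE; exact: finite_seq.
rewrite /phi (continuation_residue (rho0 s) (ex0 s) hexp zs) /residue_coef.
congr (_ * _); rewrite tauE -fsbig_seq ?filter_uniq ?uniq_chain_tuples//.
by rewrite big_map big_filter.
Qed.
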